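(* Let $\omega \in \{0,1,2\}^\infty$ be a sequence without repetition. Then the CAT(0) cube complex $\mathcal{X}$ is a model for $\underline{E}G_\omega$, the classifying space of proper actions of the Grigorchuk group $G_\omega$.
   Context: A sequence $\omega=\omega_1\omega_2\ldots$ is without repetition if $\omega_i \neq \omega_{i+1}$ for every $i$. Classifying space: a classifying space of proper actions of a group $G$, denoted $\underline{E}G$, is a topological space which admits a proper $G$-action and has the following property: if $X$ is any space with a proper $G$-action, then there exists a $G$-equivariant (continuous) map $f : X \to \underline{E}G$, and any two $G$-equivariant maps $X \to \underline{E}G$ admit a $G$-equivariant homotopy between them. Here spaces with a proper action of a discrete group $G$ are understood in the sense of Baum–Connes–Higson: $X$ and $X/G$ are metrizable, and every point of $X$ lies in a $G$-invariant open set $U$ admitting a $G$-equivariant continuous map $U \to G/H$ for some finite subgroup $H < G$. Grigorchuk groups: let $\mathcal{T}_2$ be the infinite binary rooted tree, whose vertices are the finite binary sequences. Let $\sigma$ be the shift on $\{0,1,2\}^\infty$. For $\omega \in \{0,1,2\}^\infty$, $G_\omega$ is the subgroup of $\mathrm{Aut}(\mathcal{T}_2)$ generated by $a, b_\omega, c_\omega, d_\omega$, where, for all binary sequences $x$, $a(0x)=1x$, $a(1x)=0x$, and $b_\omega(0x) = 0a(x)$ if $\omega_1 \neq 2$, $b_\omega(0x)=0x$ if $\omega_1=2$, $b_\omega(1x)=1b_{\sigma\omega}(x)$; $c_\omega(0x) = 0a(x)$ if $\omega_1 \neq 1$, $c_\omega(0x)=0x$ if $\omega_1=1$, $c_\omega(1x)=1c_{\sigma\omega}(x)$;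 $d_\omega(0x) = 0a(x)$ if $\omega_1 \neq 0$, $d_\omega(0x)=0x$ if $\omega_1=0$, $d_\omega(1x)=1d_{\sigma\omega}(x)$. The action extends to the boundary $\partial\mathcal{T}_2 = \{0,1\}^\infty$. The graph $\Gamma$: it has vertex set $V(\Gamma) = G_\omega 0^\infty$ (the set of infinite binary sequences with finitely many $1$'s) and an edge joining $x$ to $sx$ for each vertex $x$ and each $s \in \{a,b_\omega,c_\omega,d_\omega\}$; as an unlabelled graph it does not depend on $\omega$. Up to loops and multiple edges it is a bi-infinite line, drawn so that the right neighbour of $0^\infty$ is $10^\infty$ and its left neighbour is $010^\infty$. $\Gamma_+ \subset V(\Gamma)$ is the set consisting of $0^\infty$ and all the vertices to the right of it, i.e. the vertices of the connected component of $\Gamma \setminus \{0^\infty\}$ containing $10^\infty$. The cube complex $\mathcal{X}$: its vertices are the subsets $\Omega \subset V(\Gamma)$ with $\Omega \triangle \Gamma_+$ finite; two vertices are joined by an edge iff their symmetric difference has exactly one element; the $n$-cubes correspond to pairs $(A,F)$ with $F\subset V(\Gamma)$ of cardinality $n$ and $A\subset V(\Gamma)\setminus F$ a vertex of $\mathcal{X}$, the vertices of the cube being the sets $A\cup B$, $B \subset F$. It carries the CAT(0) metric induced by Euclidean unit cubes and the corresponding topology. $G_\omega$ acts on $\mathcal{X}$ by cubical automorphisms extending $\Omega \mapsto g\Omega$ on vertices. *)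

(* Defs.v *)
From HB Require Import structures.
From mathcomp Require Import all_boot all_order all_algebra.
From mathcomp Require Import all_classical all_reals all_analysis.

Set Implicit Arguments.
Unset Strict Implicit.
Unset Printing Implicit Defensive.

Import Order.TTheory GRing.Theory Num.Theory.
Import numFieldNormedType.Exports.

Local Open Scope classical_set_scope.
Local Open Scope ring_scope.

Definition is_subgroup (G : groupType) (H : set G) : Prop :=
  H 1%g /\ forall x y, H x -> H y -> H (x / y)%g.

Definition generated (G : groupType) (S : set G) : set G :=
  smallest (@is_subgroup G) S.

Definition is_left_coset (G : groupType) (H C : set G) : Prop :=
  exists g : G, C = [set (g * h)%g | h in H].

Definition metrizable (R : realType) (T : topologicalType) : Prop :=
  exists d : T -> T -> R,
    [/\ forall x y, d x y = 0 <-> x = y,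
        forall x y, d x y = d y x,
        forall x y z, d x z <= d x y + d y z &
        forall x (A : set T), nbhs x A <->
          exists2 e : R, 0 < e & [set y | d x y < e] `<=` A].

(* [G] is discrete, so that the action is continuous as soon as every element
   of [G] acts by a continuous map. *)
Record gSpace (G : groupType) : Type := GSpace {
  gSpace_sort :> topologicalType;
  gact : G -> gSpace_sort -> gSpace_sort;
  gact1 : forall x, gact 1%g x = x;
  gactM : forall g h x, gact (g * h)%g x = gact g (gact h x);
  gact_continuous : forall g, continuous (gact g) }.

Section OrbitSpace.
Context {G : groupType} (X : gSpace G).

Definition same_orbit : rel X := fun x y => `[< exists g : G, y = gact g x >].

Lemma same_orbit_refl : reflexive same_orbit.
Proof. by move=> x; apply/asboolP; exists 1%g; rewrite gact1. Qed.

Lemma same_orbit_sym : symmetric same_orbit.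
Proof.
suff H x y : same_orbit x y -> same_orbit y x.
  by move=> x y; apply/idP/idP => /H.
move=> /asboolP[g ->]; apply/asboolP; exists g^-1%g.
by rewrite -gactM mulVg gact1.
Qed.

Lemma same_orbit_trans : transitive same_orbit.
Proof.
move=> y x z /asboolP[g ->] /asboolP[h ->]; apply/asboolP.
by exists (h * g)%g; rewrite gactM.
Qed.

Definition orbit_equiv : equiv_rel X :=
  EquivRel same_orbit same_orbit_refl same_orbit_sym same_orbit_trans.

Definition orbit_space : topologicalType :=
  quotient_topology {eq_quot orbit_equiv}%qT.

End OrbitSpace.

Section Equivariant.
Context {G : groupType}.

Definition equivariant (X Y : gSpace G) (f : X -> Y) : Prop :=
  forall g x, f (gact g x) = gact g (f x).

(* The slice map [rho] takes its values in [G/H], seen inside the discrete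
   space of all subsets of [G], on which [G] acts by left translation. *)
Definition proper_action (R : realType) (X : gSpace G) : Prop :=
  [/\ metrizable R X, metrizable R (orbit_space X) &
    forall x : X, exists (U : set X) (H : set G)
        (rho : X -> discrete_topology (set G)),
      [/\ open U /\ U x,
          forall g y, U y -> U (gact g y),
          is_subgroup H /\ finite_set H,
          {within U, continuous rho} &
          forall y, U y -> is_left_coset H (rho y) /\
            forall g, rho (gact g y) = [set (g * h)%g | h in rho y]]].

Definition equivariantly_homotopic (R : realType) (X Y : gSpace G)
    (f0 f1 : X -> Y) : Prop :=
  exists F : X * R -> Y,
    [/\ {within [set: X] `*` `[0, 1], continuous F},
        forall x, F (x, 0) = f0 x,
        forall x, F (x, 1) = f1 x &
        forall t, 0 <= t <= 1 -> equivariant (fun x => F (x, t))].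

Definition classifying_space_of_proper_actions (R : realType) (E : gSpace G) :
    Prop :=
  proper_action R E /\
  forall X : gSpace G, proper_action R X ->
    (exists f : X -> E, continuous f /\ equivariant f) /\
    forall f0 f1 : X -> E,
      continuous f0 -> equivariant f0 -> continuous f1 -> equivariant f1 ->
      equivariantly_homotopic R f0 f1.

End Equivariant.

(* The vertices of the binary rooted tree are the binary words; [false] and
   [true] stand for the letters 0 and 1. *)
Definition tree_child (s t : seq bool) : bool :=
  [exists x : bool, t == rcons s x].

(* Preserving the parent-child relation amounts to preserving adjacency and the
   root. *)
Record treeAut : Type := TreeAut {
  taut :> seq bool -> seq bool;
  taut_inv : seq bool -> seq bool;
  tautK : cancel taut taut_inv;
  taut_invK : cancel taut_inv taut;
  taut_child : forall s t, tree_child (taut s) (taut t) = tree_child s t }.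

HB.instance Definition _ := gen_eqMixin treeAut.
HB.instance Definition _ := gen_choiceMixin treeAut.

Lemma treeAut_eq (g h : treeAut) : g =1 h -> g = h.
Proof.
case: g h => [f f' fK f'K fc] [h h' hK h'K hc] /= fh.
have E : f = h by exact/funext.
subst h; have E : f' = h'.
  by apply/funext => s; rewrite -{1}(h'K s) fK.
by subst h'; congr TreeAut; exact: Prop_irrelevance.
Qed.

Section TreeAutGroup.

Definition taut_one : treeAut :=
  @TreeAut id id (fun=> erefl) (fun=> erefl) (fun _ _ => erefl).

Lemma taut_inv_child (g : treeAut) s t :
  tree_child (taut_inv g s) (taut_inv g t) = tree_child s t.
Proof. by rewrite -(taut_child g) !taut_invK. Qed.

Definition taut_V (g : treeAut) : treeAut :=
  TreeAut (@taut_invK g) (@tautK g) (taut_inv_child g).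

Lemma taut_comp_child (g h : treeAut) s t :
  tree_child (g (h s)) (g (h t)) = tree_child s t.
Proof. by rewrite !taut_child. Qed.

Definition taut_mul (g h : treeAut) : treeAut :=
  @TreeAut (g \o h) (taut_inv h \o taut_inv g)
    (can_comp (@tautK g) (@tautK h)) (can_comp (@taut_invK h) (@taut_invK g))
    (taut_comp_child g h).

Lemma taut_mulA : associative taut_mul.
Proof. by move=> f g h; exact: treeAut_eq. Qed.
Lemma taut_mul1 : left_id taut_one taut_mul.
Proof. by move=> g; exact: treeAut_eq. Qed.
Lemma taut_mul1r : right_id taut_one taut_mul.
Proof. by move=> g; exact: treeAut_eq. Qed.
Lemma taut_mulV : left_inverse taut_one taut_V taut_mul.
Proof. by move=> g; apply: treeAut_eq => s /=; rewrite tautK. Qed.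
Lemma taut_mulVr : right_inverse taut_one taut_V taut_mul.
Proof. by move=> g; apply: treeAut_eq => s /=; rewrite taut_invK. Qed.

End TreeAutGroup.

HB.instance Definition _ :=
  isGroup.Build treeAut taut_mulA taut_mul1 taut_mul1r taut_mulV taut_mulVr.

(* The letters of [w] are indexed from 0, so that [w 0] is the first one. *)
Definition shift (w : nat -> 'I_3) : nat -> 'I_3 := fun n => w n.+1.

Definition without_repetition (w : nat -> 'I_3) : Prop :=
  forall i, w i != w i.+1.

Definition flip (s : seq bool) : seq bool :=
  if s is x :: s' then ~~ x :: s' else [::].

(* [spinal k w] acts trivially below the letter 0 exactly at the levels where
   [w] takes the value [k]; thus b, c and d correspond to k = 2, 1 and 0. *)
Fixpoint spinal (k : nat) (w : nat -> 'I_3) (s : seq bool) : seq bool :=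
  match s with
  | [::] => [::]
  | false :: s' => false :: (if w 0%N == k :> nat then s' else flip s')
  | true :: s' => true :: spinal k (shift w) s'
  end.

Lemma flipK : involutive flip.
Proof. by case=> //= x s; rewrite negbK. Qed.

Lemma spinalK k w : involutive (spinal k w).
Proof.
move=> s; elim: s w => [//|[] s IHs] w /=; first by rewrite IHs.
by case: eqP => // _; rewrite flipK.
Qed.

Lemma flip_rcons s x : exists y, flip (rcons s x) = rcons (flip s) y.
Proof. by case: s => [|z s] /=; [exists (~~ x) | exists x]. Qed.

Lemma spinal_rcons k w s x :
  exists y, spinal k w (rcons s x) = rcons (spinal k w s) y.
Proof.
elim: s w => [|[] s IHs] w /=.
- by case: x; [exists true | exists false; case: ifP].
- by case: (IHs (shift w)) => y ->; exists y.
- by case: ifP => _; [exists x | case: (flip_rcons s x) => y ->; exists y].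
Qed.

Lemma involutive_child (f : seq bool -> seq bool) : involutive f ->
  (forall s x, exists y, f (rcons s x) = rcons (f s) y) ->
  forall s t, tree_child (f s) (f t) = tree_child s t.
Proof.
move=> fK fr; have H s t : tree_child s t -> tree_child (f s) (f t).
  move=> /existsP[x /eqP->]; have [y ->] := fr s x.
  by apply/existsP; exists y.
by move=> s t; apply/idP/idP => /H; rewrite ?fK.
Qed.

Definition tree_a : treeAut :=
  TreeAut flipK flipK (involutive_child flipK flip_rcons).

Definition tree_spinal k w : treeAut :=
  TreeAut (@spinalK k w) (@spinalK k w)
    (involutive_child (@spinalK k w) (@spinal_rcons k w)).

Definition tree_b := tree_spinal 2.
Definition tree_c := tree_spinal 1.
Definition tree_d := tree_spinal 0.

Definition grigorchuk_gens (w : nat -> 'I_3) : set treeAut :=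
  [set tree_a; tree_b w; tree_c w; tree_d w].

Definition grigorchuk (w : nat -> 'I_3) : Type :=
  {g : treeAut | g \in generated (grigorchuk_gens w)}.

HB.instance Definition _ w := [isSub of grigorchuk w for sval].
HB.instance Definition _ w := [Choice of grigorchuk w by <:].

Lemma generated_group_closed (G : groupType) (S : set G) :
  group_closed (fun g => g \in generated S).
Proof.
split=> [|x y]; first by rewrite inE => H [[]].
rewrite !inE /generated => Sx Sy H HS.
by have [[_ HB] _] := HS; apply: HB; [exact: Sx|exact: Sy].
Qed.

HB.instance Definition _ w := SubChoice_isSubGroup.Build treeAut
  (fun g => g \in generated (grigorchuk_gens w)) (grigorchuk w)
  (generated_group_closed (grigorchuk_gens w)).

Lemma grigorchuk_valM w (g h : grigorchuk w) :
  val (g * h)%g = (val g * val h)%g.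
Proof. exact: gmulfM. Qed.

Lemma grigorchuk_val1 w : val (1%g : grigorchuk w) = 1%g.
Proof. exact: gmulf1. Qed.

(* The [n]-th letter of the image of an infinite word is the [n]-th letter of
   the image of any of its prefixes of length greater than [n]. *)
Definition boundary_act (g : treeAut) (x : nat -> bool) : nat -> bool :=
  fun n => nth false (g (mkseq x n.+1)) n.

Section BoundaryAct.
Implicit Types g h : treeAut.

Lemma tree_childP s t : reflect (exists x, t = rcons s x) (tree_child s t).
Proof.
by apply: (iffP existsP) => -[x]; [move/eqP|move->]; exists x.
Qed.

Lemma taut_nil g : g [::] = [::].
Proof.
case/lastP E: (g [::]) => [//|s x].
have : tree_child (g (taut_inv g s)) (g [::]).
  by rewrite taut_invK E; apply/tree_childP; exists x.
by rewrite taut_child => /tree_childP[y]; case: (taut_inv g s).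
Qed.

Lemma taut_rcons g s x : exists y, g (rcons s x) = rcons (g s) y.
Proof.
by apply/tree_childP; rewrite taut_child; apply/tree_childP; exists x.
Qed.

Lemma size_taut g s : size (g s) = size s.
Proof.
elim/last_ind: s => [|s x IHs]; first by rewrite taut_nil.
by have [y ->] := taut_rcons g s x; rewrite !size_rcons IHs.
Qed.

Lemma mkseqSr (T : Type) (f : nat -> T) n :
  mkseq f n.+1 = rcons (mkseq f n) (f n).
Proof. by rewrite /mkseq -addn1 iotaD map_cat cats1. Qed.

Lemma mkseq_boundary_act g x n : mkseq (boundary_act g x) n = g (mkseq x n).
Proof.
elim: n => [|n IHn]; first by rewrite taut_nil.
rewrite mkseqSr IHn /boundary_act mkseqSr.
have [y ->] := taut_rcons g (mkseq x n) (x n).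
by rewrite nth_rcons size_taut size_mkseq ltnn eqxx.
Qed.

Lemma boundary_act1 x : boundary_act 1%g x = x.
Proof. by apply/funext => n; rewrite /boundary_act /= nth_mkseq. Qed.

Lemma boundary_actM g h x :
  boundary_act (g * h)%g x = boundary_act g (boundary_act h x).
Proof.
by apply/funext => n; rewrite {2}/boundary_act mkseq_boundary_act.
Qed.

Lemma boundary_actK g : cancel (boundary_act g) (boundary_act g^-1%g).
Proof. by move=> x; rewrite -boundary_actM mulVg boundary_act1. Qed.

Lemma boundary_actVK g : cancel (boundary_act g^-1%g) (boundary_act g).
Proof. by move=> x; rewrite -boundary_actM mulgV boundary_act1. Qed.

End BoundaryAct.

Definition zeros : nat -> bool := fun=> false.
Definition one_zeros : nat -> bool := fun n => n == 0%N.

Definition gvertex (w : nat -> 'I_3) : Type :=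
  {x : nat -> bool |
    x \in range (fun g : grigorchuk w => boundary_act (val g) zeros)}.

HB.instance Definition _ w := [isSub of gvertex w for sval].
HB.instance Definition _ w := [Choice of gvertex w by <:].

Lemma finite_setY_trans T (A B C : set T) :
  finite_set (A `+` B) -> finite_set (B `+` C) -> finite_set (A `+` C).
Proof.
move=> AB BC; apply: (@sub_finite_set _ _ ((A `+` B) `|` (B `+` C))).
  by move=> x /=; have [Bx|Bx] := pselect (B x); tauto.
by rewrite finite_setU.
Qed.

Lemma finite_setYD T (A B D : set T) :
  finite_set (A `+` B) -> finite_set D -> finite_set ((A `\` D) `+` B).
Proof.
move=> AB Dfin; apply: (@sub_finite_set _ _ ((A `+` B) `|` D)).
  by move=> v /=; have [Av|Av] := pselect (A v);
    have [Dv|Dv] := pselect (D v); tauto.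
by rewrite finite_setU.
Qed.

Section Graph.
Context {w : nat -> 'I_3}.

Lemma gvertex_act_subproof (g : grigorchuk w) (v : gvertex w) :
  boundary_act (val g) (val v) \in
    range (fun g : grigorchuk w => boundary_act (val g) zeros).
Proof.
case: v => /= x; rewrite !inE => -[h _ <-].
by exists (g * h)%g => //; rewrite grigorchuk_valM boundary_actM.
Qed.

Definition gvertex_act (g : grigorchuk w) (v : gvertex w) : gvertex w :=
  Sub (boundary_act (val g) (val v)) (gvertex_act_subproof g v).

Lemma gvertex_act1 v : gvertex_act 1%g v = v.
Proof. by apply: val_inj; rewrite -[RHS]boundary_act1 -(grigorchuk_val1 w). Qed.

Lemma gvertex_actM g h v :
  gvertex_act (g * h)%g v = gvertex_act g (gvertex_act h v).
Proof.
by apply: val_inj; apply: etrans (boundary_actM _ _ _); rewrite -grigorchuk_valM.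
Qed.

Lemma gvertex_actK g : cancel (gvertex_act g) (gvertex_act g^-1%g).
Proof. by move=> x; rewrite -gvertex_actM mulVg gvertex_act1. Qed.

Lemma gvertex_actVK g : cancel (gvertex_act g^-1%g) (gvertex_act g).
Proof. by move=> x; rewrite -gvertex_actM mulgV gvertex_act1. Qed.

Definition gamma_adj (u v : gvertex w) : Prop :=
  exists2 s, grigorchuk_gens w s &
    val v = boundary_act s (val u) \/ val u = boundary_act s (val v).

(* The connected component of 10^oo in the graph with 0^oo removed. *)
Inductive right_component : gvertex w -> Prop :=
| right_base v : val v = one_zeros -> right_component v
| right_step u v : right_component u -> gamma_adj u v -> val v <> zeros ->
    right_component v.

Definition gamma_plus : set (gvertex w) :=
  [set v | val v = zeros \/ right_component v].

Definition is_cvertex (A : set (gvertex w)) : Prop :=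
  finite_set (A `+` gamma_plus).

Let gp : set (nat -> bool) := val @` gamma_plus.

Let almost_stable (g : treeAut) : Prop :=
  finite_set ((boundary_act g @^-1` gp) `+` gp).

Let almost_stable_subgroup : is_subgroup [set g | almost_stable g].
Proof.
split=> [|g h Pg Ph].
  rewrite /= /almost_stable.
  have -> : boundary_act 1%g @^-1` gp = gp.
    by apply/seteqP; split=> x /=; rewrite boundary_act1.
  by rewrite setYK.
have finV (A : set (nat -> bool)) :
    finite_set A -> finite_set (boundary_act h^-1%g @^-1` A).
  by apply: finite_preimage => x y _ _; exact: (can_inj (boundary_actVK h)).
rewrite /= /almost_stable.
have -> : boundary_act (g / h)%g @^-1` gp =
    boundary_act h^-1%g @^-1` (boundary_act g @^-1` gp).
  by apply/seteqP; split=> x /=; rewrite boundary_actM.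
apply: (finite_setY_trans (finV _ Pg)).
rewrite setYC.
have -> : gp = boundary_act h^-1%g @^-1` (boundary_act h @^-1` gp).
  by apply/seteqP; split=> x /=; rewrite boundary_actVK.
have := finV _ Ph.
rewrite [X in _ -> finite_set (_ `+` X)](_ : _ = boundary_act h^-1%g @^-1` gp) //.
by apply/seteqP; split=> x /=; rewrite !boundary_actVK.
Qed.

Lemma gens_grigorchuk s :
  grigorchuk_gens w s -> s \in generated (grigorchuk_gens w).
Proof. by move=> sS; rewrite inE; exact: sub_gen_smallest. Qed.

Lemma gvertex_zerosP :
  zeros \in range (fun g : grigorchuk w => boundary_act (val g) zeros).
Proof. by rewrite inE; exists 1%g => //; rewrite grigorchuk_val1 boundary_act1. Qed.

Let gp_zeros : gp zeros.
Proof. by exists (Sub zeros gvertex_zerosP : gvertex w) => //; left. Qed.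

Let almost_stable_gens : grigorchuk_gens w `<=` [set g | almost_stable g].
Proof.
move=> s sS; rewrite /= /almost_stable.
pose g : grigorchuk w := Sub s (gens_grigorchuk sS).
apply: (@sub_finite_set _ _ [set zeros; boundary_act s^-1%g zeros]); last first.
  by rewrite finite_setU; split; exact: finite_set1.
move=> x /= [[[v vp vs] nx]|[[v vp vx] nsx]].
- have [v0|v0] := pselect (val v = zeros).
    by right; rewrite -v0 vs boundary_actK.
  have [x0|x0] := pselect (x = zeros); first by left.
  case: vp => // rv.
  have xE : x = val (gvertex_act g^-1%g v) by rewrite /= vs boundary_actK.
  case: nx; rewrite xE; exists (gvertex_act g^-1%g v) => //; right.
  apply: (right_step rv); last by rewrite -xE.
  by exists s => //; right; rewrite -xE.
- left; apply: contrapT => x0; apply: nsx.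
  case: vp => [v0|rv]; first by rewrite -vx v0 in x0.
  rewrite -vx.
  have [y0|y0] := pselect (boundary_act s (val v) = zeros).
    by rewrite y0.
  exists (gvertex_act g v) => //; right.
  by apply: (right_step rv) => //; exists s => //; left.
Qed.

Lemma gamma_plus_almost_stable (g : grigorchuk w) :
  finite_set ((gvertex_act g @^-1` gamma_plus) `+` gamma_plus).
Proof.
have gS : almost_stable (val g).
  have /set_mem := valP g.
  exact: (smallest_sub almost_stable_subgroup almost_stable_gens).
apply: (@sub_finite_set _ _ (val @^-1` ((boundary_act (val g) @^-1` gp) `+` gp))).
  have gpE v : gp (val v) = gamma_plus v.
    apply/propext; split; last by exists v.
    by move=> [u pu /val_inj <-].
  move=> v /=.
  by rewrite -(gpE v) -(gpE (gvertex_act g v)).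
apply: finite_preimage => //.
by move=> u v _ _; exact: val_inj.
Qed.

(* The cubes of the complex are the pairs [(cbase, cdirs)]. *)
Record cube : Type := Cube {
  cbase : set (gvertex w);
  cdirs : set (gvertex w);
  cbase_vertex : is_cvertex cbase;
  cdirs_finite : finite_set cdirs;
  cbase_dirs : cbase `&` cdirs = set0 }.

Lemma cube_act_vertex (g : grigorchuk w) (c : cube) :
  is_cvertex (gvertex_act g @` cbase c).
Proof.
have -> : gvertex_act g @` cbase c = gvertex_act g^-1%g @^-1` cbase c.
  apply/seteqP; split=> [_ [v cv <-]|v /= cv]; first by rewrite /= gvertex_actK.
  by exists (gvertex_act g^-1%g v) => //; rewrite gvertex_actVK.
apply: (@finite_setY_trans _ _ (gvertex_act g^-1%g @^-1` gamma_plus)); last first.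
  exact: gamma_plus_almost_stable.
apply: (@finite_preimage _ _ _ (gvertex_act g^-1%g) _ (cbase_vertex c)).
by move=> u v _ _; exact: (can_inj (gvertex_actVK g)).
Qed.

Lemma cube_act_disj (g : grigorchuk w) (c : cube) :
  (gvertex_act g @` cbase c) `&` (gvertex_act g @` cdirs c) = set0.
Proof.
rewrite eqEsubset; split=> // x [[u cu ux] [v cv vx]].
have E : u = v by apply: (can_inj (gvertex_actK g)); rewrite ux vx.
have : (cbase c `&` cdirs c) u by split=> //; rewrite E.
by rewrite cbase_dirs.
Qed.

Definition cube_act (g : grigorchuk w) (c : cube) : cube :=
  Cube (cube_act_vertex g c)
    (finite_image (gvertex_act g) (@cdirs_finite c)) (cube_act_disj g c).

End Graph.
Arguments cube w : clear implicits.

(* The cube [(A, F)] is realized as the set of functions equal to 1 on [A], to 0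
   outside of [A] and [F], and with values in [0, 1] on [F]: the vertex
   [A `|` B] is its indicator function, and restricting to a face of a cube
   agrees with the coordinates of that face. *)
Definition in_cube (R : realType) (w : nat -> 'I_3) (c : cube w)
    (x : gvertex w -> R) : Prop :=
  forall v, [/\ cbase c v -> x v = 1,
                cdirs c v -> 0 <= x v <= 1 &
                ~ cbase c v -> ~ cdirs c v -> x v = 0].

Record cube_complex (R : realType) (w : nat -> 'I_3) : Type := CubePoint {
  coord :> gvertex w -> R;
  coordP : exists c : cube w, in_cube c coord }.

HB.instance Definition _ R w := gen_eqMixin (cube_complex R w).
HB.instance Definition _ R w := gen_choiceMixin (cube_complex R w).

Lemma cube_complex_eq R w (x y : cube_complex R w) : x =1 y -> x = y.
Proof.
case: x y => [x xP] [y yP] /= /funext E; subst y.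
by congr CubePoint; exact: Prop_irrelevance.
Qed.

Section Metric.
Context {R : realType} {w : nat -> 'I_3}.
Implicit Types x y z : cube_complex R w.

Definition euclidean_dist (c : cube w) x y : R :=
  Num.sqrt (\sum_(v \in cdirs c) (x v - y v) ^+ 2).

(* [is_string x y l]: some sequence of points from [x] to [y], in which any two
   consecutive points lie in a common cube, has total length [l]. *)
Inductive is_string : cube_complex R w -> cube_complex R w -> R -> Prop :=
| string_nil x : is_string x x 0
| string_cons (c : cube w) x y z l :
    in_cube c x -> in_cube c y -> is_string y z l ->
    is_string x z (euclidean_dist c x y + l).

(* The length metric induced by the Euclidean metrics of the unit cubes. *)
Definition cube_dist x y : R := inf [set l | is_string x y l].

Lemma euclidean_distC c x y : euclidean_dist c x y = euclidean_dist c y x.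
Proof.
rewrite /euclidean_dist; congr Num.sqrt.
by apply: eq_fsbigr => v _; rewrite -sqrrN opprB.
Qed.

Lemma string_trans x y z l l' :
  is_string x y l -> is_string y z l' -> is_string x z (l + l').
Proof.
elim=> [{}x|c {}x u {}y {}l cx cu _ IH] yz; first by rewrite add0r.
by rewrite -addrA; apply: (string_cons cx cu); exact: IH.
Qed.

Lemma string_sym x y l : is_string x y l -> is_string y x l.
Proof.
elim=> [{}x|c {}x u {}y {}l cx cu _ IH]; first exact: string_nil.
rewrite addrC; apply: (string_trans IH).
by rewrite euclidean_distC -[X in is_string _ _ X]addr0;
  apply: (string_cons cu cx); exact: string_nil.
Qed.

Lemma common_cube x y : exists c : cube w, in_cube c x /\ in_cube c y.
Proof.
have [[A F FA Ffin AF] cx] := coordP x; have [[B E EB Efin BE] cy] := coordP y.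
have ABfin : finite_set (A `+` B).
  by apply: (finite_setY_trans FA); rewrite setYC.
pose D := (F `|` E) `|` (A `+` B).
have Dfin : finite_set D by rewrite !finite_setU in ABfin *.
have DF v : F v -> D v by move=> ?; left; left.
have DE v : E v -> D v by move=> ?; left; right.
have DAB v : A v -> ~ B v -> D v by move=> ? ?; right; left.
have DBA v : B v -> ~ A v -> D v by move=> ? ?; right; right.
have AD0 : (A `\` D) `&` D = set0.
  by apply/seteqP; split=> // v [[_ nD] /nD].
exists (Cube (finite_setYD FA Dfin : is_cvertex _) Dfin AD0); split=> v; split=> /=.
- by move=> [Av _]; have [->] := cx v.
- move=> _; have [/= xA xF x0] := cx v.
  have [Av|Av] := pselect (A v); first by rewrite xA // ler01 lexx.
  have [Fv|Fv] := pselect (F v); first exact: xF.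
  by rewrite x0 // lexx ler01.
- move=> nAD nD; have [_ _ /= x0] := cx v.
  by apply: x0 => [Av|/DF//]; apply: nAD.
- move=> [Av nD]; have [/= -> //] := cy v.
  by apply: contrapT => /(DAB _ Av).
- move=> _; have [/= xA xF x0] := cy v.
  have [Av|Av] := pselect (B v); first by rewrite xA // ler01 lexx.
  have [Fv|Fv] := pselect (E v); first exact: xF.
  by rewrite x0 // lexx ler01.
- move=> nAD nD; have [_ _ /= x0] := cy v.
  apply: x0 => [Bv|/DE//]; apply: nAD; split=> //.
  by apply: contrapT => /(DBA _ Bv).
Qed.

Lemma string_exists x y : [set l | is_string x y l] !=set0.
Proof.
have [c [cx cy]] := common_cube x y.
by exists (euclidean_dist c x y + 0); apply: (string_cons cx cy (string_nil y)).
Qed.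

Lemma coord_le_string x y l v : is_string x y l -> `|x v - y v| <= l.
Proof.
elim=> [{}x|c {}x u {}y {}l cx cu _ IH]; first by rewrite subrr normr0.
rewrite -(subrKA (u v)); apply: (le_trans (ler_normD _ _)); apply: lerD => //.
have [cv|cv] := pselect (cdirs c v).
  rewrite -sqrtr_sqr /euclidean_dist ler_sqrt; last first.
    by apply: fsumr_ge0 => ? _; exact: sqr_ge0.
  rewrite (fsbigD1 v) //=; last exact: cdirs_finite.
  by rewrite lerDl; apply: fsumr_ge0 => ? _; exact: sqr_ge0.
have -> : x v = u v.
  have [x1 _ x0] := cx v; have [u1 _ u0] := cu v.
  by have [bv|bv] := pselect (cbase c v); [rewrite x1 ?u1|rewrite x0 ?u0].
by rewrite subrr normr0 sqrtr_ge0.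
Qed.

Lemma string_ge0 x y l : is_string x y l -> 0 <= l.
Proof. by elim=> // *; apply: addr_ge0 => //; exact: sqrtr_ge0. Qed.

Lemma cube_dist_le x y l : is_string x y l -> cube_dist x y <= l.
Proof. by move=> s; apply: ge_inf => //; exists 0 => k; exact: string_ge0. Qed.

Lemma cube_distxx x : cube_dist x x = 0.
Proof.
apply/eqP; rewrite eq_le cube_dist_le; last exact: string_nil.
by apply: lb_le_inf; [exact: string_exists|move=> l; exact: string_ge0].
Qed.

Lemma cube_dist_eq0 x y : cube_dist x y = 0 -> x = y.
Proof.
move=> d0; apply: cube_complex_eq => v; apply/eqP.
rewrite -subr_eq0 -normr_le0 -d0.
apply: lb_le_inf; first exact: string_exists.
by move=> l; exact: coord_le_string.
Qed.

Lemma cube_dist_sym x y : cube_dist x y = cube_dist y x.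
Proof.
by congr inf; apply/seteqP; split=> l; exact: string_sym.
Qed.

Lemma cube_dist_triangle y x z : cube_dist x z <= cube_dist x y + cube_dist y z.
Proof.
rewrite -lerBlDr; apply: lb_le_inf; first exact: string_exists.
move=> l xy; rewrite lerBlDr -lerBlDl.
apply: lb_le_inf; first exact: string_exists.
by move=> l' yz; rewrite lerBlDl; apply: cube_dist_le; exact: string_trans xy yz.
Qed.

End Metric.

HB.instance Definition _ (R : realType) (w : nat -> 'I_3) :=
  isMetric.Build R (cube_complex R w)
    cube_distxx cube_dist_eq0 cube_dist_sym cube_dist_triangle.

Section Action.
Context {R : realType} {w : nat -> 'I_3}.
Implicit Types (g h : grigorchuk w) (x y : cube_complex R w) (c : cube w).

Lemma in_cube_act g c (x : gvertex w -> R) : in_cube c x ->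
  in_cube (cube_act g c) (fun v => x (gvertex_act g^-1%g v)).
Proof.
have imE (A : set (gvertex w)) v : (gvertex_act g @` A) v = A (gvertex_act g^-1%g v).
  apply/propext; split=> [[u Au <-]|Av]; first by rewrite gvertex_actK.
  by exists (gvertex_act g^-1%g v) => //; rewrite gvertex_actVK.
by move=> cx v; have := cx (gvertex_act g^-1%g v); rewrite -!imE.
Qed.

Lemma cube_complex_act_subproof g x :
  exists c : cube w, in_cube c (fun v => x (gvertex_act g^-1%g v)).
Proof. by have [c cx] := coordP x; exists (cube_act g c); exact: in_cube_act. Qed.

Definition cube_complex_act g x : cube_complex R w :=
  CubePoint (cube_complex_act_subproof g x).

Lemma cube_complex_act_indic g x (A : set (gvertex w)) :
  (forall v, x v = \1_A v) ->
  forall v, cube_complex_act g x v = \1_(gvertex_act g @` A) v.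
Proof.
move=> xA v; rewrite /= xA /indic; congr (_%:R); congr nat_of_bool.
apply/idP/idP; rewrite !inE; last by move=> [u Au <-]; rewrite gvertex_actK.
by move=> h; exists (gvertex_act g^-1%g v) => //; rewrite gvertex_actVK.
Qed.

Lemma cube_complex_act1 x : cube_complex_act 1%g x = x.
Proof. by apply: cube_complex_eq => v; rewrite /= invg1 gvertex_act1. Qed.

Lemma cube_complex_actM g h x :
  cube_complex_act (g * h)%g x = cube_complex_act g (cube_complex_act h x).
Proof. by apply: cube_complex_eq => v; rewrite /= invgM gvertex_actM. Qed.

Lemma cube_complex_act_string g x y l :
  is_string x y l -> is_string (cube_complex_act g x) (cube_complex_act g y) l.
Proof.
elim=> [{}x|c {}x u {}y {}l cx cu _ IH]; first exact: string_nil.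
have -> : euclidean_dist c x u =
    euclidean_dist (cube_act g c) (cube_complex_act g x) (cube_complex_act g u).
  rewrite /euclidean_dist /= fsbig_image; last first.
    by move=> ? ? _ _; exact: (can_inj (gvertex_actK g)).
  by congr Num.sqrt; apply: eq_fsbigr => v _; rewrite gvertex_actK.
by apply: string_cons IH; exact: in_cube_act.
Qed.

Lemma cube_complex_act_continuous g : continuous (cube_complex_act g).
Proof.
move=> x A /nbhs_ballP[e e0 eA]; apply/nbhs_ballP; exists e => // y xy.
apply: eA; move: xy; rewrite !ballEmdist /=; apply: le_lt_trans.
apply: lb_le_inf; first exact: string_exists.
by move=> l xy; apply: cube_dist_le; exact: cube_complex_act_string.
Qed.

End Action.

Definition grigorchuk_cube_complex (R : realType) (w : nat -> 'I_3) :
    gSpace (grigorchuk w) :=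
  GSpace (@cube_complex_act1 R w) (@cube_complex_actM R w)
    (@cube_complex_act_continuous R w).

(* Main.v *)
From mathcomp Require Import all_boot all_order all_algebra.
From mathcomp Require Import all_classical all_reals all_analysis.
From mathcomp Require Import zify lra ring wochoice.
Require Import Defs.

(** In the coordinates indexed by the vertices of the line, the complex is the
    set of all functions with values in [0, 1] that agree with the indicator of
    Gamma_+ off a finite set. It is convex, the group acts on it by permuting
    the coordinates, and the distance of two points is at most their Euclidean
    distance. Any two equivariant maps into it are therefore joined by a
    straight-line homotopy ([segment_homotopy]).

    For the existence of an equivariant map from a proper space, a slice
    modelled on G/H is sent to the orbit of a point fixed by the finite group H,
    namely a barycenter ([finite_subgroup_fixpoint], [slice_map]). These local
    maps are locally constant, and have to be averaged by means of an invariant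
    partition of unity with supports in the slices. It is obtained on a
    pseudometric space as follows: the slices are well ordered; for each n, one
    keeps the points for which the first slice containing them contains a ball
    of radius 3/n. The neighbourhoods of radius 1/n of the sets so obtained for
    different slices are disjoint, so that a single function is enough for
    each n, and these countably many functions are made locally finite by
    subtracting from each a large multiple of the previous ones ([bump]).

    The action is proper because it is isometric, with discrete orbits (a point
    has finitely many values among its coordinates) and finite stabilizers
    ([proper_isometric_action]). Finiteness of stabilizers is where the sequence
    matters. The stabilizer of a point preserves the set A of the vertices where
    the coordinate is 1, and A differs from Gamma_+ by a finite set. Below each
    of the letters 0 and 1, a half-line of the line is again a half-line, and
    after finitely many levels the finite difference is reduced to 0^oo
    ([stab_finite]). It remains to determine the stabilizers of Gamma_+ and of
    Gamma_+ without 0^oo, which are contained in the dihedral group of order 8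
    generated by a and the letter w 0, respectively in the group {1, b, c, d}
    ([stab_halflines]). This is proved by induction on the length of words, by
    passing to sections. The point is that an element acting trivially below 1,
    and below 0 by an element t of the dihedral group of the next level, has to
    be trivial ([klein_of_sections]). A letter other than w 0 leaves a trace in
    both sections, so that the parities of the numbers of letters in t are
    forced by the triviality of the other section; these parities are well
    defined because every tail of the sequence takes two values, and they
    detect the letter w 1 because w 1 differs from w 0. *)

Set Implicit Arguments.
Unset Strict Implicit.
Unset Printing Implicit Defensive.

Import Order.TTheory GRing.Theory Num.Theory.
Import numFieldNormedType.Exports.

Local Open Scope classical_set_scope.

(** * Words in the generators and their sections *)

Definition scons (b : bool) (x : nat -> bool) : nat -> bool :=
  fun n => if n is m.+1 then x m else b.

Definition stail (x : nat -> bool) : nat -> bool := fun n => x n.+1.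

Lemma scons_stail x : scons (x 0) (stail x) = x.
Proof. by apply/funext => -[]. Qed.

Lemma scons_inj b c x y : scons b x = scons c y -> b = c /\ x = y.
Proof.
move=> E; split; first exact: (congr1 (@^~ 0) E).
by apply/funext => n; exact: (congr1 (@^~ n.+1) E).
Qed.

Lemma scons_false_zeros : scons false zeros = zeros.
Proof. by apply/funext => -[]. Qed.

Definition bflip (x : nat -> bool) : nat -> bool := scons (~~ x 0) (stail x).

(** Recursion on the position of the letter that is read off, infinite words
    having no structure to recurse on. *)
Fixpoint bspinal (k : 'I_3) (w : nat -> 'I_3) (x : nat -> bool) (n : nat) :=
  if n is m.+1 then
    if x 0 then bspinal k (shift w) (stail x) m
    else if w 0 == k then x m.+1 else bflip (stail x) m
  else x 0.

(** [None] stands for a, and [Some k] for the generator acting trivially below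
    the letter 0 at the levels where the sequence takes the value k. *)
Definition letter := option 'I_3.

Definition lact (w : nat -> 'I_3) (l : letter) : (nat -> bool) -> nat -> bool :=
  if l is Some k then bspinal k w else bflip.

Definition weval w (W : seq letter) : (nat -> bool) -> nat -> bool :=
  foldr (fun l f => lact w l \o f) id W.

Definition count_a (W : seq letter) : nat := count (pred1 None) W.

Definition count_neq (i : 'I_3) (W : seq letter) : nat :=
  count (fun l => if l is Some k then k != i else false) W.

(** Only a moves the first letter of a word. *)
Definition root_swap (W : seq letter) : bool := odd (count_a W).

Arguments count_a : simpl never.
Arguments count_neq : simpl never.
Arguments root_swap : simpl never.

Definition lsec (w : nat -> 'I_3) (l : letter) (x : bool) : seq letter :=
  if l is Some k then
    if x then [:: Some k] else if w 0 == k then [::] else [:: None]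
  else [::].

(** The word by which [W] acts below the letter [x]. Words act from right to
    left, so the subtree met by a letter of [W] is decided by the parity of the
    number of a to its right. *)
Fixpoint sec w (x : bool) (W : seq letter) : seq letter :=
  if W is l :: W' then lsec w l (x (+) root_swap W') ++ sec w x W' else [::].

Lemma bflip_scons b x : bflip (scons b x) = scons (~~ b) x.
Proof. by apply/funext => -[]. Qed.

Lemma bspinal_true k w x :
  bspinal k w (scons true x) = scons true (bspinal k (shift w) x).
Proof. by apply/funext => -[]. Qed.

Lemma bspinal_false k w x :
  bspinal k w (scons false x) =
  scons false (if w 0 == k then x else bflip x).
Proof. by apply/funext => -[|n] //=; case: ifP. Qed.

Lemma bflipK : involutive bflip.
Proof. by move=> x; apply/funext => -[|n] //=; rewrite /bflip /= negbK. Qed.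

Lemma bspinalK k w : involutive (bspinal k w).
Proof.
move=> x; apply/funext => n; elim: n x w => [//|n IHn] x w.
rewrite -(scons_stail x); case: (x 0); first by rewrite !bspinal_true [LHS]IHn.
rewrite !bspinal_false; case: (w 0 == k) => //.
by rewrite bflipK.
Qed.

Lemma lactK w l : involutive (lact w l).
Proof. by case: l => [k|]; [exact: bspinalK|exact: bflipK]. Qed.

Lemma weval_cat w W U : weval w (W ++ U) = weval w W \o weval w U.
Proof. by elim: W => [//|l W IHW] /=; rewrite IHW. Qed.

Lemma wevalK w W : cancel (weval w W) (weval w (rev W)).
Proof.
elim: W => [//|l W IHW] x.
by rewrite rev_cons -cats1 weval_cat /= lactK IHW.
Qed.

Lemma wevalVK w W : cancel (weval w (rev W)) (weval w W).
Proof. by move=> x; rewrite -{1}(revK W) wevalK. Qed.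

Lemma root_swap_cat W U : root_swap (W ++ U) = root_swap W (+) root_swap U.
Proof. by rewrite /root_swap /count_a count_cat oddD. Qed.

Lemma count_neq_cat i W U :
  count_neq i (W ++ U) = count_neq i W + count_neq i U.
Proof. by rewrite /count_neq count_cat. Qed.

Lemma sec_cat w x W U :
  sec w x (W ++ U) = sec w (x (+) root_swap U) W ++ sec w x U.
Proof.
elim: W => [//|l W IHW] /=; rewrite IHW catA; congr ((lsec w l _ ++ _) ++ _).
by rewrite root_swap_cat addbAC addbA.
Qed.

Lemma weval_scons w W x y :
  weval w W (scons x y) =
  scons (x (+) root_swap W) (weval (shift w) (sec w x W) y).
Proof.
elim: W => [|l W IHW]; first by rewrite addbF.
rewrite /= weval_cat IHW /=; case: l => [k|] /=.
  rewrite -[Some k :: W]cat1s root_swap_cat addFb.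
  case: (x (+) root_swap W); rewrite ?bspinal_true ?bspinal_false //=.
  by case: ifP.
by rewrite bflip_scons -[None :: W]cat1s root_swap_cat addbA addbT addNb.
Qed.

(** Every a disappears and every other letter leaves at most one letter. The
    sections of a word containing a are therefore strictly shorter, which makes
    induction on the length possible; the words without a only yield
    1, b, c, d. *)
Lemma size_sec w x W : size (sec w x W) + count_a W <= size W.
Proof.
elim: W => [//|l W IHW] /=; rewrite size_cat /count_a /=.
suff : (l == None) + size (lsec w l (x (+) root_swap W)) <= 1.
  move=> h; apply: leq_trans (leq_add h IHW).
  by rewrite -/(count_a W) /=; lia.
by case: l => [k|] //=; case: ifP => // _; case: ifP.
Qed.

Lemma weval_eq_sec w W U : weval w W = weval w U ->
  root_swap W = root_swap U /\
  forall x, weval (shift w) (sec w x W) = weval (shift w) (sec w x U).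
Proof.
move=> E; split.
  have := congr1 (@^~ (scons false zeros)) E; rewrite /= !weval_scons.
  by move/scons_inj => [].
move=> x; apply/funext => y.
have := congr1 (@^~ (scons x y)) E; rewrite /= !weval_scons.
by move/scons_inj => [].
Qed.

Lemma sec_eq_weval w W U : root_swap W = root_swap U ->
  (forall x, weval (shift w) (sec w x W) = weval (shift w) (sec w x U)) ->
  weval w W = weval w U.
Proof.
move=> tE sE; apply/funext => x.
by rewrite -(scons_stail x) !weval_scons tE sE.
Qed.

(** A letter other than [w 0] acts by itself below 1 and by a below 0, so that
    it leaves one letter of each kind, one in each section. *)
Lemma count_a_sec w x W :
  count_a (sec w x W) = count_neq (w 0) (sec w (~~ x) W).
Proof.
elim: W => [//|l W IHW] /=.
rewrite /count_a count_cat count_neq_cat -IHW; congr (_ + _).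
case: l => [k|] //=; rewrite addNb; case: (x (+) root_swap W) => //=.
  by case: eqVneq => //= ->.
by rewrite eq_sym /count_neq /=; case: eqVneq.
Qed.

Lemma count_neq_sec w i W :
  count_neq i (sec w false W) + count_neq i (sec w true W) = count_neq i W.
Proof.
elim: W => [//|l W IHW] /=.
rewrite !count_neq_cat -[l :: W]cat1s count_neq_cat -IHW addnACA.
congr (_ + _); case: l => [k|] //=; case: (root_swap W) => /=;
  by case: ifP => //=; rewrite ?addn0.
Qed.

(** The letters other than [w 0] are as many as the a in both sections, and
    these are even in number when the sections fix the first letter. For the
    next values of [w] one goes down to the sections, among which the letters
    of [W] are distributed. *)
Lemma count_neq_even w W :
  weval w W = id -> forall n, ~~ odd (count_neq (w n) W).
Proof.
move=> + n; elim: n w W => [|n IHn] w W E.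
all: have [tW sW] := @weval_eq_sec w W [::] E.
all: rewrite -(count_neq_sec w) oddD.
  have [tf _] := @weval_eq_sec _ _ [::] (sW false).
  have [tt _] := @weval_eq_sec _ _ [::] (sW true).
  have nt := count_a_sec w true W; have nf := count_a_sec w false W.
  rewrite /= in nt nf.
  by rewrite -nt -nf; rewrite /root_swap in tf tt; rewrite tf tt.
have := IHn _ _ (sW false); have := IHn _ _ (sW true).
by rewrite /shift => /negbTE -> /negbTE ->.
Qed.

Lemma ord3_neq (i p q k : 'I_3) : i != p -> i != q -> p != q ->
  (k != i) = (k != p) (+) (k != q).
Proof.
rewrite -!val_eqE; move: i p q k.
by do 4!move=> [[|[|[|?]]] ?].
Qed.

Lemma count_neq_third (i p q : 'I_3) W : i != p -> i != q -> p != q ->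
  odd (count_neq i W) = odd (count_neq p W) (+) odd (count_neq q W).
Proof.
move=> ip iq pq; elim: W => [//|l W IHW].
have E j : odd (count_neq j (l :: W)) =
    (if l is Some k then k != j else false) (+) odd (count_neq j W).
  by rewrite /count_neq /= oddD oddb.
rewrite !E IHW [RHS]addbACA; congr (_ (+) _).
by case: l {E} => [k|] //; exact: ord3_neq.
Qed.

(** Parities of numbers of letters are invariants of the element as soon as
    the sequence takes two values: these give two of the three parities, and
    the third one is their sum. *)
Lemma count_neq_parity w i W U :
  without_repetition w -> weval w W = weval w U ->
  odd (count_neq i W) = odd (count_neq i U).
Proof.
move=> hw E.
have EV : weval w (W ++ rev U) = id.
  by rewrite weval_cat E; apply/funext => x /=; rewrite wevalVK.
suff : ~~ odd (count_neq i (W ++ rev U)).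
  rewrite count_neq_cat oddD {2}/count_neq count_rev -/(count_neq i U).
  by rewrite negb_add => /eqP.
have [->|i0] := eqVneq i (w 0); first exact: count_neq_even EV 0.
have [->|i1] := eqVneq i (w 1); first exact: count_neq_even EV 1.
rewrite (count_neq_third _ i0 i1 (hw 0)).
by rewrite (negbTE (count_neq_even EV 0)) (negbTE (count_neq_even EV 1)).
Qed.

Lemma without_repetition_shift w :
  without_repetition w -> without_repetition (shift w).
Proof. by move=> hw i; exact: hw. Qed.

(** Sort the letters of [W] other than [w 0] in two types, according to the
    section that receives the letter while the other section receives a. The
    left-hand side counts the pairs made of one letter of each type, in either
    order: in each section, a letter is kept below 0 when the number of a to its
    right is odd. The right-hand side is the product of the parities of the
    numbers of letters of the two types. *)
Lemma count_neq_sec_sec w W (v := shift w) :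
  odd (count_neq (w 0) (sec v false (sec w false W))) (+)
  odd (count_neq (w 0) (sec v false (sec w true W))) =
  root_swap (sec w false W) && root_swap (sec w true W).
Proof.
elim: W => [//|l W]; rewrite /= !sec_cat !count_neq_cat !oddD !root_swap_cat.
case: l => [k|] /=; last by [].
move: (odd (count_neq (w 0) (sec v false (sec w false W)))) => A.
move: (odd (count_neq (w 0) (sec v false (sec w true W)))) => B.
move: (root_swap W) (root_swap (sec w false W)) (root_swap (sec w true W)).
have [wk|wk] := eqVneq (w 0) k.
  case; case; case => <-; rewrite /count_neq /=; case: (v 0 == k) => /=;
    by rewrite ?wk ?eqxx /=; case: A; case: B.
have kw : (k != w 0) by rewrite eq_sym.
case; case; case => /=; rewrite /count_neq /=; case: (v 0 == k) => /=;
  by rewrite ?kw /=; case: A; case: B.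
Qed.

(** * Stabilizers of half-lines *)

Definition last_one (e : bool) (x : nat -> bool) : Prop :=
  exists m, [/\ odd m = e, x m & forall k, m < k -> x k = false].

(** On the line, 0^oo separates the vertices whose last 1 has an even index
    from those whose last 1 has an odd index. These are the four half-lines
    ending there: [e] chooses the side, and [z] tells whether the end point
    belongs to the half-line. *)
Definition halfline (z e : bool) : set (nat -> bool) :=
  [set x | (x = zeros /\ z) \/ last_one e x].

Lemma last_one_zeros e : ~ last_one e zeros.
Proof. by case=> m []. Qed.

Lemma last_one_scons e b y :
  last_one e (scons b y) <-> [/\ ~~ e, b & y = zeros] \/ last_one (~~ e) y.
Proof.
split=> [[[|m] [me ym y0]]|].
- left; split=> //; first by rewrite -me.
  by apply/funext => n; exact: (y0 n.+1).
- right; exists m; split=> //; first by rewrite -me /= negbK.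
  by move=> k mk; exact: (y0 k.+1).
- case=> [[e0 b1 ->]|[m [me ym y0]]].
    by exists 0; split=> //=; [rewrite (negbTE e0)|case].
  exists m.+1; split=> //; first by rewrite /= me negbK.
  by case=> // k mk; exact: y0.
Qed.

Lemma scons_eq_zeros b y : scons b y = zeros <-> b = false /\ y = zeros.
Proof.
by rewrite -{1}scons_false_zeros; split=> [/scons_inj|[-> ->]//].
Qed.

Lemma halfline_zeros z e : halfline z e zeros <-> z.
Proof. by split=> [[[]|/last_one_zeros]|] //; left. Qed.

(** Going down to a subtree turns a half-line into a half-line on the other
    side; this self-similarity lets the stabilizers be computed by
    recursion. The half-lines with [z = e] reproduce themselves below 1. *)
Lemma halfline_scons z e b y :
  halfline z e (scons b y) <-> halfline (if b then ~~ e else z) (~~ e) y.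
Proof.
rewrite /halfline /= last_one_scons scons_eq_zeros.
split.
  case=> [[[-> ->] z1]|[[e0 -> ->]|y1]]; [by left|by left|by right].
case=> [[-> ze]|y1]; last by right; right.
by case: b ze => ?; [right; left|left].
Qed.

Definition maps w W (A B : set (nat -> bool)) : Prop :=
  forall x, A x <-> B (weval w W x).

Lemma maps_cat w W U A B C :
  maps w U A B -> maps w W B C -> maps w (W ++ U) A C.
Proof. by move=> UAB WBC x; rewrite UAB WBC weval_cat. Qed.

Lemma maps_rev w W A B : maps w W A B -> maps w (rev W) B A.
Proof. by move=> WAB x; rewrite WAB wevalVK. Qed.

Lemma maps_sec w W A B x : maps w W A B ->
  maps (shift w) (sec w x W) (A \o scons x) (B \o scons (x (+) root_swap W)).
Proof. by move=> WAB y; rewrite /= WAB weval_scons. Qed.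

Lemma maps_halfline_sec w W z e z' e' x :
  maps w W (halfline z e) (halfline z' e') ->
  maps (shift w) (sec w x W) (halfline (if x then ~~ e else z) (~~ e))
    (halfline (if x (+) root_swap W then ~~ e' else z') (~~ e')).
Proof. by move=> M y; rewrite -!halfline_scons; exact: (maps_sec x M). Qed.

(** The group {1, b, c, d}. *)
Definition klein (v : option 'I_3) : seq letter :=
  if v is Some k then [:: Some k] else [::].

Lemma bspinal_comp (k l m : 'I_3) w x : k != l -> m != k -> m != l ->
  bspinal k w (bspinal l w x) = bspinal m w x.
Proof.
move=> kl mk ml; apply/funext => n; elim: n x w => [//|n IHn] x w.
rewrite -(scons_stail x); case: (x 0); first by rewrite !bspinal_true [LHS]IHn.
rewrite !bspinal_false; congr scons.
have := @ord3_neq m k l (w 0) mk ml kl.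
case: (w 0 == m); case: (w 0 == k); case: (w 0 == l) => //= _.
by rewrite bflipK.
Qed.

Lemma klein_cons w k v : exists u,
  weval w (Some k :: klein v) = weval w (klein u).
Proof.
case: v => [l|]; last by exists (Some k).
have [->|kl] := eqVneq k l.
  by exists None; apply/funext => x /=; rewrite bspinalK.
have [m /andP[mk ml]] : exists m : 'I_3, (m != k) && (m != l).
  apply/existsP; apply: contraT; rewrite negb_exists => /forallP H.
  have := H (inord 0); have := H (inord 1); have := H (inord 2).
  rewrite -!val_eqE /= !inordK //.
  by move: k l {kl H} => [[|[|[|?]]] ?] [[|[|[|?]]] ?].
by exists (Some m); apply/funext => x /=; exact: bspinal_comp.
Qed.

Lemma klein_of_count_a0 w W :
  count_a W = 0 -> exists v, weval w W = weval w (klein v).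
Proof.
elim: W => [|[k|] W IHW]; [by exists None| |by rewrite /count_a].
rewrite /count_a /= add0n => /IHW[v vE].
by have [u uE] := klein_cons w k v; exists u; rewrite -uE /= vE.
Qed.

Lemma sec_false_klein w v :
  sec w false (klein v) = [::] \/ sec w false (klein v) = [:: None].
Proof. by case: v => [k|] /=; [case: (_ == _); [left|right]|left]. Qed.

Lemma kleinK w v : involutive (weval w (klein v)).
Proof. by case: v => [k|] x //=; rewrite bspinalK. Qed.

Lemma halfline_one_zeros z e : halfline z e (bflip zeros) <-> ~~ e.
Proof. by rewrite /bflip /= halfline_scons halfline_zeros. Qed.

Lemma maps_weval w W U A B :
  weval w W = weval w U -> maps w W A B -> maps w U A B.
Proof. by move=> E H x; rewrite -E; exact: H. Qed.

(** Moving the end point of a half-line in or out would again be done by a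
    section, either at once below 0 or in two steps when the first letter is
    moved; a word without a acts below 0 by 1 or by a, which cannot do it. *)
Lemma halfline_zero_invariant w W z z' e :
  maps w W (halfline z e) (halfline z' e) -> z = z'.
Proof.
have [n] := ubnP (size W); elim: n => // n IHn in w W z z' e *.
rewrite ltnS => Wn WM.
have [na0|na_gt0] := posnP (count_a W).
  have [v vE] := klein_of_count_a0 w na0.
  have := maps_halfline_sec false (maps_weval vE WM).
  have -> : root_swap (klein v) = false by case: v {vE}.
  have [->|->] := sec_false_klein w v; move=> H.
    have := H zeros; rewrite /= !halfline_zeros => {}H.
    by apply/idP/idP; case: H.
  have := H zeros; have := H (bflip zeros).
  rewrite /= bflipK !halfline_zeros !halfline_one_zeros.
  by case: (z) (z') (e) => -[] [] // [h1 h2] [h3 h4]; (try have := h1 isT);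
     (try have := h2 isT); (try have := h3 isT); (try have := h4 isT).
have IH x := @IHn (shift w) (sec w x W).
have lt x : size (sec w x W) < n.
  by have := size_sec w x W; lia.
have Mf := maps_halfline_sec false WM; have Mt := maps_halfline_sec true WM.
case: (root_swap W) Mf Mt => /= Mf Mt; last exact: IH Mf.
by rewrite (IH _ _ _ _ _ Mf) // (IH _ _ _ _ _ Mt).
Qed.

(** Words for the elements of the dihedral group of order 8 generated by a and
    the letter [i = w 0]. This letter acts by itself below 1 and trivially below
    0, and its conjugate by a acts below 0 only, so that these two commute. *)
Definition dihedral (i : 'I_3) (p q s : bool) : seq letter :=
  (if p then [:: Some i] else [::]) ++
  (if q then [:: None; Some i; None] else [::]) ++
  (if s then [:: None] else [::]).

Lemma root_swap_dihedral i p q s : root_swap (dihedral i p q s) = s.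
Proof. by case: p q s => -[] []. Qed.

Lemma sec_dihedral w p q s x : sec w x (dihedral (w 0) p q s) =
  (if p && (x (+) s) then [:: Some (w 0)] else [::]) ++
  (if q && ~~ (x (+) s) then [:: Some (w 0)] else [::]).
Proof.
by case: p q s x => -[] [] [] //=; rewrite /root_swap /= ?eqxx.
Qed.

Lemma count_neq_dihedral i j p q s :
  odd (count_neq j (dihedral i p q s)) = (i != j) && (p (+) q).
Proof. by case: p q s => -[] []; rewrite /count_neq /=; case: (i != j). Qed.

Lemma dihedral_a w i p q s :
  weval w (dihedral i p q s ++ [:: None]) = weval w (dihedral i p q (~~ s)).
Proof.
rewrite /dihedral !weval_cat; apply/funext => x.
by case: s => //=; rewrite bflipK.
Qed.

Section Stabilizers.
Variables (w : nat -> 'I_3) (W : seq letter).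
Hypothesis hw : without_repetition w.

(** The section below 1 being trivial, all its letter counts are even, and they
    are exchanged with those of the section below 0. Hence the latter has an
    even number of a and an even number of letters other than [w 0], among which
    [w 1]: this leaves 1 and the product of the two commuting letters of the
    dihedral group. One more level excludes this product, by
    [count_neq_sec_sec]. If [w] began by a repetition, the counts would not see
    the letter [w 1]. *)
Lemma klein_of_sections :
  ~~ root_swap W ->
  (exists p q s, weval (shift w) (sec w false W) =
     weval (shift w) (dihedral (w 1) p q s)) ->
  weval (shift w) (sec w true W) = id ->
  weval w W = id.
Proof.
move=> tW [p [q [s E0]]] E1.
have hw' := without_repetition_shift hw.
have hw'' := without_repetition_shift hw'.
set v := shift w in E0 E1 hw' hw''.
have [tU1 sU1] := @weval_eq_sec v _ [::] E1.
have [tU0 sU0] := weval_eq_sec E0.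
have w01 : w 1 != w 0 by rewrite eq_sym; exact: hw.
have cn1 := @count_neq_parity v (w 0) _ [::] hw' E1.
have cn0 := count_neq_parity (w 0) hw' E0.
have s0 : s = false.
  by rewrite -(root_swap_dihedral (w 1) p q s) -tU0 /root_swap count_a_sec.
have pq : p (+) q = false.
  have := count_neq_dihedral (w 1) (w 0) p q s; rewrite w01 /= => <-.
  by rewrite -cn0 -(count_a_sec w true).
have q0 : q = false.
  have := count_neq_sec_sec w W; rewrite /= -/v tU1 andbF.
  rewrite (count_neq_parity (w 0) hw'' (sU0 false)).
  rewrite (count_neq_parity (w 0) hw'' (sU1 false)).
  rewrite (sec_dihedral v) s0 /= andbF addbF andbT /=.
  by case: q {E0 tU0 sU0 cn0 pq} => //; rewrite /count_neq /= w01.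
have p0 : p = false by move: pq; rewrite q0 addbF.
apply: (@sec_eq_weval _ _ [::]); first exact: negbTE.
by case=> //; rewrite E0 p0 q0 s0.
Qed.

End Stabilizers.

(** The half-lines are considered up to complement, hence the two cases. The
    sections of a word stabilizing one of them stabilize half-lines, and are
    known by induction on the length. *)
Lemma stab_halflines w W e : without_repetition w ->
  (maps w W (halfline e e) (halfline e e) ->
     exists v, weval w W = weval w (klein v)) /\
  (maps w W (halfline (~~ e) e) (halfline (~~ e) e) ->
     exists p q s, weval w W = weval w (dihedral (w 0) p q s)).
Proof.
have [n] := ubnP (size W); elim: n => // n IHn in w W e *.
rewrite ltnS => Wn hw; have hw' := without_repetition_shift hw.
have [na0|na_gt0] := posnP (count_a W).
  have [v vE] := klein_of_count_a0 w na0.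
  split=> [_|M0]; first by exists v.
  have M := maps_weval vE M0; clear M0.
  rewrite vE; case: v {vE} M => [k|] M; last by exists false, false, false.
  have [->|wk] := eqVneq k (w 0); first by exists true, false, false.
  have := M zeros; rewrite /= -scons_false_zeros bspinal_false.
  rewrite eq_sym (negbTE wk) !halfline_scons !halfline_zeros /= !negbK.
  by case: (e) => -[h1 h2] //; [have := h2 isT|have := h1 isT].
have lt x : size (sec w x W) < n.
  by have := size_sec w x W; lia.
have IH x e' := IHn (shift w) (sec w x W) e' (lt x) hw'.
split=> M.
  have tW : root_swap W = false.
    (* Exchanging the two subtrees would move the end point of a half-line. *)
    apply/negP => tW; have Mf := maps_halfline_sec false M.
    by rewrite tW in Mf; have := halfline_zero_invariant Mf; case: (e).
  have [_ /(_ _)[|p [q [s E0]]]] := IH false (~~ e).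
    by have := maps_halfline_sec false M; rewrite tW negbK.
  have [/(_ _)[|v E1 _]] := IH true (~~ e).
    by have := maps_halfline_sec true M; rewrite tW.
  (* Dividing by the element with the same section below 1 leaves an element
     which acts below 0 only. *)
  exists v.
  have tv : root_swap (klein v) = false by case: (v).
  have : weval w (W ++ klein v) = id.
    apply: klein_of_sections => //; first by rewrite root_swap_cat tW tv.
      rewrite sec_cat tv addFb.
      have [->|->] := sec_false_klein w v.
        by rewrite cats0; exists p, q, s.
      exists p, q, (~~ s).
      by rewrite weval_cat E0 -weval_cat dihedral_a.
    have -> : sec w true (W ++ klein v) = sec w true W ++ klein v.
      by rewrite sec_cat tv; case: (v).
    by rewrite weval_cat E1; apply/funext => x; exact: kleinK.
  rewrite weval_cat => E; apply/funext => x.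
  by have := congr1 (@^~ (weval w (klein v) x)) E; rewrite /= kleinK.
(* Both sections belong to {1, b, c, d}. As neither contains an odd number of a,
   neither contains an odd number of letters other than [w 0]. *)
have E x : exists b : bool, weval (shift w) (sec w x W) =
    weval (shift w) (if b then [:: Some (w 0)] else [::]).
  have Ev y : exists v, weval (shift w) (sec w y W) =
      weval (shift w) (klein v).
    have [/(_ _)[|v vE _]] := IH y (~~ e); last by exists v.
    by have := maps_halfline_sec y M; rewrite !if_same.
  have [v vE] := Ev x; have [u uE] := Ev (~~ x).
  have : odd (count_neq (w 0) (klein v)) = false.
    rewrite -(count_neq_parity (w 0) hw' vE) -[x in sec w x]negbK -count_a_sec.
    rewrite -/(root_swap _).
    have [-> _] := weval_eq_sec uE.
    by case: (u).
  rewrite vE; case: v {vE} => [k|] /=; last by exists false.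
  rewrite /count_neq /= addn0 oddb => /negbFE/eqP ->.
  by exists true.
have [b0 E0] := E false; have [b1 E1] := E true.
exists (if root_swap W then b0 else b1), (if root_swap W then b1 else b0).
exists (root_swap W).
apply: sec_eq_weval => [|x]; first by rewrite root_swap_dihedral.
rewrite sec_dihedral; case: x; rewrite ?E0 ?E1; case: (root_swap W) => /=;
  by rewrite ?andbF ?andbT ?cats0.
Qed.

Definition stabset w (A : set (nat -> bool)) :
    set ((nat -> bool) -> nat -> bool) :=
  [set f | exists2 W, f = weval w W & maps w W A A].

Definition bounded_by (n : nat) (x : nat -> bool) : Prop :=
  forall m, n <= m -> x m = false.

Lemma stab_halfline_finite w z e : without_repetition w ->
  finite_set (stabset w (halfline z e)).
Proof.
move=> hw.
pose F (t : option 'I_3 + bool * bool * bool) :=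
  match t with
  | inl v => weval w (klein v)
  | inr (p, q, s) => weval w (dihedral (w 0) p q s)
  end.
apply: (@sub_finite_set _ _ (F @` setT)); last exact/finite_image/finite_finset.
move=> _ [W -> WM]; have [HQ HP] := stab_halflines W e hw.
have [ze|ze] := eqVneq z e.
  by move: WM; rewrite ze => /HQ[v ->]; exists (inl v).
have {}ze : z = ~~ e by case: z e ze {WM HQ HP} => -[].
by move: WM; rewrite ze => /HP[p [q [s ->]]]; exists (inr (p, q, s)).
Qed.

(** The elements fixing the first letter are determined by their two sections,
    and they form a subgroup of index at most 2. *)
Lemma stab_sections_finite w (A : set (nat -> bool)) :
  (forall x, finite_set (stabset (shift w) (A \o scons x))) ->
  finite_set (stabset w A).
Proof.
move=> Afin.
pose glue (f : ((nat -> bool) -> nat -> bool) * ((nat -> bool) -> nat -> bool))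
    (x : nat -> bool) := scons (x 0) ((if x 0 then f.2 else f.1) (stail x)).
pose S0 := [set f | exists W,
  [/\ f = weval w W, maps w W A A & root_swap W = false]].
have S0fin : finite_set S0.
  apply: (@sub_finite_set _ _ (glue @` (stabset (shift w) (A \o scons false)
      `*` stabset (shift w) (A \o scons true)))); last first.
    by apply/finite_image/finite_setX; exact: Afin.
  move=> _ [W [-> WM tW]].
  exists (weval (shift w) (sec w false W), weval (shift w) (sec w true W)).
    split; [exists (sec w false W) => //|exists (sec w true W) => //].
      by have := maps_sec false WM; rewrite tW.
    by have := maps_sec true WM; rewrite tW.
  apply/funext => x; rewrite -{2}(scons_stail x) weval_scons tW addbF /glue.
  by case: (x 0).
have [[U UM tU]|noU] := pselect (exists2 U, maps w U A A & root_swap U).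
  apply: (@sub_finite_set _ _ (S0 `|` [set weval w U \o f | f in S0]));
    last first.
    by rewrite finite_setU; split=> //; exact: finite_image.
  move=> _ [W -> WM]; case tW: (root_swap W); last by left; exists W.
  right; exists (weval w (rev U ++ W)).
    exists (rev U ++ W); split=> //; first exact: maps_cat WM (maps_rev UM).
    rewrite root_swap_cat tW {1}/root_swap /count_a count_rev.
    by rewrite -/(count_a U) -/(root_swap U) tU.
  by apply/funext => x; rewrite weval_cat /= wevalVK.
apply: sub_finite_set S0fin => _ [W -> WM]; exists W; split=> //.
by apply/negbTE/negP => tW; apply: noU; exists W.
Qed.

(** Each level of the tree removes one letter from the words at which [A] and
    the half-line differ, until they differ at 0^oo at most; then [A] is a
    half-line itself. *)
Lemma stab_finite w (A : set (nat -> bool)) z e n : without_repetition w ->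
  (forall x, ~ bounded_by n x -> A x <-> halfline z e x) ->
  finite_set (stabset w A).
Proof.
elim: n => [|n IHn] in w A z e * => hw AE.
  suff -> : A = halfline `[< A zeros >] e by exact: stab_halfline_finite.
  apply/seteqP; split=> x.
    have [->|x0] := pselect (x = zeros).
      by move=> Ax; apply/halfline_zeros/asboolP.
    move=> /AE[b|[]//|]; last by right.
    by apply: x0; apply/funext => m; exact: b.
  move=> [[-> /asboolP]//|ex]; apply/AE; last by right.
  move=> b; have E : x = zeros by apply/funext => m; exact: b.
  by move: ex; rewrite E => /last_one_zeros.
apply: stab_sections_finite => x.
apply: (IHn _ _ (if x then ~~ e else z) (~~ e)) (without_repetition_shift hw) _.
move=> y yn; rewrite /= AE ?halfline_scons// => b; apply: yn => m nm.
exact: (b m.+1).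
Qed.

(** * The group and the vertices of the line *)

Lemma mkseqSl (x : nat -> bool) n : mkseq x n.+1 = x 0 :: mkseq (stail x) n.
Proof. by rewrite /mkseq /= -[1]addn0 iotaDl -map_comp. Qed.

Definition gen w (l : letter) : treeAut :=
  if l is Some k then tree_spinal k w else tree_a.

Lemma nth_flip_mkseq x n : nth false (flip (mkseq x n.+1)) n = bflip x n.
Proof. by rewrite mkseqSl; case: n => [|n] //=; rewrite nth_mkseq. Qed.

Lemma boundary_act_gen w l : boundary_act (gen w l) = lact w l.
Proof.
apply/funext => x; apply/funext => n.
case: l => [k|]; last exact: nth_flip_mkseq.
rewrite /boundary_act; elim: n w x => [|n IHn] w x; rewrite mkseqSl /=.
  by case: (x 0) => //; case: ifP.
case: (x 0) => /=; first exact: IHn.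
rewrite -val_eqE /=; case: ifP => _; last exact: nth_flip_mkseq.
exact: (@nth_mkseq _ false (stail x) n.+1 n).
Qed.

Lemma gensP w s : grigorchuk_gens w s <-> exists l, s = gen w l.
Proof.
split=> [[[[->|->]|->]|->]|[[k|] ->]].
- by exists None.
- by exists (Some (inord 2)); rewrite /= inordK.
- by exists (Some (inord 1)); rewrite /= inordK.
- by exists (Some (inord 0)); rewrite /= inordK.
- case: k => [[|[|[|//]]] ?] /=; [right|left; right|left; left; right]; by [].
- by left; left; left.
Qed.

Lemma boundary_act_word w (g : grigorchuk w) :
  exists W, boundary_act (val g) = weval w W.
Proof.
have /set_mem := valP g.
apply: (smallest_sub (X := [set g | exists W, boundary_act g = weval w W])).
  split=> [|x y [W WE] [U UE]].
    by exists [::]; apply/funext => x; rewrite boundary_act1.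
  exists (W ++ rev U); apply/funext => z.
  rewrite boundary_actM weval_cat WE /=; congr (weval w W _).
  by rewrite -{2}(boundary_actVK y z) UE wevalK.
move=> s /gensP[l ->]; exists [:: l].
by rewrite boundary_act_gen.
Qed.

Lemma boundary_act_inj : injective boundary_act.
Proof.
move=> g h E; apply: treeAut_eq => s.
have := mkseq_boundary_act g (nth false s) (size s).
by rewrite E mkseq_boundary_act mkseq_nth => ->.
Qed.

Lemma bounded_by_scons n b y : bounded_by n y -> bounded_by n.+1 (scons b y).
Proof. by move=> yn [|m] //; exact: yn. Qed.

Lemma bounded_by_stail n b y : bounded_by n.+1 (scons b y) -> bounded_by n y.
Proof. by move=> yn m nm; exact: (yn m.+1). Qed.

Lemma bounded_by0 x : bounded_by 0 x -> x = zeros.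
Proof. by move=> x0; apply/funext => m; exact: x0. Qed.

Lemma bounded_by_le m n x : m <= n -> bounded_by m x -> bounded_by n x.
Proof. by move=> mn xm k nk; apply: xm; exact: leq_trans nk. Qed.

Lemma bounded_by_bflip n x : bounded_by n x -> bounded_by n.+1 (bflip x).
Proof. by move=> xn; apply: bounded_by_scons => m nm; apply: xn; lia. Qed.

Lemma bounded_by_lact w l n x : bounded_by n x -> bounded_by n.+2 (lact w l x).
Proof.
case: l => [k|] xn; last by apply: bounded_by_le (bounded_by_bflip xn).
rewrite /=; elim: n w x xn => [|n IHn] w x.
  move=> /bounded_by0 ->; rewrite -scons_false_zeros bspinal_false.
  apply: bounded_by_scons; case: ifP => _ //.
  exact: bounded_by_bflip.
rewrite -(scons_stail x) => /bounded_by_stail xn.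
case: (x 0); first by rewrite bspinal_true; apply: bounded_by_scons; exact: IHn.
rewrite bspinal_false; apply: bounded_by_scons.
case: ifP => _; first by apply: bounded_by_le xn; lia.
by apply: bounded_by_le (bounded_by_bflip xn); lia.
Qed.

Lemma gvertex_bounded w (v : gvertex w) : exists n, bounded_by n (val v).
Proof.
have /set_mem[g _ <-] := valP v; have [W ->] := boundary_act_word g.
elim: W => [|l W [n Wn]]; first by exists 0.
by exists n.+2; exact: bounded_by_lact.
Qed.

Lemma gvertex_seq_bounded w (s : seq (gvertex w)) :
  exists n, forall v, v \in s -> bounded_by n (val v).
Proof.
elim: s => [|u s [n sn]]; first by exists 0.
have [m um] := gvertex_bounded u; exists (maxn m n) => v.
rewrite inE => /predU1P[->|/sn vn].
  exact: bounded_by_le (leq_maxl _ _) um.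
exact: bounded_by_le (leq_maxr _ _) vn.
Qed.

Lemma last_one_bounded e x : last_one e x -> exists n, bounded_by n x.
Proof. by case=> m [_ _ xm]; exists m.+1. Qed.

Lemma last_one_bflip e x : last_one e x ->
  last_one e (bflip x) \/ ~~ e /\ bflip x = zeros.
Proof.
rewrite -(scons_stail x) bflip_scons !last_one_scons scons_eq_zeros.
by move=> [[e0 -> ->]|]; [right|left; right].
Qed.

(** The letter changed by a spinal generator follows 1...10. If it is the last
    1, the new last 1 is two places before, unless the word becomes 0^oo; if it
    comes after the last 1, the latter moves two places forward. *)
Lemma last_one_bspinal k w e x : last_one e x ->
  last_one e (bspinal k w x) \/ e /\ bspinal k w x = zeros.
Proof.
move=> ex; have [n xn] := last_one_bounded ex.
elim: n => [|n IHn] in w e x ex xn *.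
  by move: ex; rewrite (bounded_by0 xn) => /last_one_zeros.
move: ex xn; rewrite -(scons_stail x); set y := stail x.
case: (x 0) => + /bounded_by_stail yn.
  rewrite bspinal_true !last_one_scons => -[[e0 _ ->]|ey].
    left; rewrite -scons_false_zeros bspinal_false; case: ifP => _.
      by left.
    by right; rewrite (negbTE e0) !last_one_scons; right; left.
  have [ey'|[e0 ->]] := IHn (shift w) (~~ e) y ey yn; first by left; right.
  by left; left.
rewrite bspinal_false !last_one_scons scons_eq_zeros => -[[_ //]|ey].
case: ifP => _; first by left; right.
have [ey'|[+ ->]] := last_one_bflip ey; first by left; right.
by rewrite negbK; right.
Qed.

Lemma last_one_lact w l x : last_one false x ->
  last_one false (lact w l x) \/ lact w l x = zeros.
Proof.
case: l => [k|] /= x0; last by have [|[]] := last_one_bflip x0; [left|right].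
by have [|[]//] := last_one_bspinal k w x0; left.
Qed.

(** Connectedness off 0^oo is expressed by the sets closed under the moves that
    avoid it: a path below the letter 1 is then transported by taking the
    preimage of such a set. *)
Definition closed_off_zeros w (T : set (nat -> bool)) : Prop :=
  forall x l, T x -> lact w l x <> zeros -> T (lact w l x).

Lemma other_label (i : 'I_3) : exists k : 'I_3, i != k.
Proof.
have [->|] := eqVneq i ord0; last by exists ord0.
by exists (inord 1); rewrite -val_eqE /= inordK.
Qed.

(** The letters other than a act by themselves below 1; the move a below 1 is
    obtained by going to the subtree below 0, where some letter acts by a, and
    coming back. *)
Lemma closed_off_zeros_tail w (T : set (nat -> bool)) :
  closed_off_zeros w T ->
  closed_off_zeros (shift w) [set y | y <> zeros /\ T (scons true y)].
Proof.
move=> Tc x l /= [x0 Tx] lx0; split=> //; case: l lx0 => [k|] /= lx0.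
  rewrite -bspinal_true; apply: (Tc _ (Some k) Tx).
  by rewrite /= bspinal_true scons_eq_zeros => -[].
have Ta b y : y <> zeros -> T (scons b y) -> T (scons (~~ b) y).
  move=> y0 Ty; rewrite -bflip_scons; apply: (Tc _ None Ty).
  by rewrite /= bflip_scons scons_eq_zeros => -[].
apply: (Ta false) => //.
have [k wk] := other_label (w 0).
have -> : scons false (bflip x) = lact w (Some k) (scons false x).
  by rewrite /= bspinal_false (negbTE wk).
apply: Tc; first exact: (Ta true).
by rewrite /= bspinal_false (negbTE wk) scons_eq_zeros => -[].
Qed.

Definition first_vertex (e : bool) : nat -> bool :=
  if e then scons false (scons true zeros) else scons true zeros.

(** Removing the first letter changes the parity of the index of the last 1,
    which is why both parities are treated together. *)
Lemma last_one_reachable w (T : set (nat -> bool)) e x :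
  closed_off_zeros w T -> T (first_vertex e) -> last_one e x -> T x.
Proof.
move=> Tc Te ex; have [n xn] := last_one_bounded ex.
elim: n => [|n IHn] in w T e x Tc Te ex xn *.
  by move: ex; rewrite (bounded_by0 xn) => /last_one_zeros.
move: ex xn; rewrite -(scons_stail x); set y := stail x; set b := x 0.
rewrite last_one_scons => -[[e0 -> ->] _|ey /bounded_by_stail yn].
  by move: Te; rewrite (negbTE e0).
have y0 : y <> zeros by move=> y0; move: ey; rewrite y0 => /last_one_zeros.
suff Ty : T (scons true y).
  case: (b) => //; rewrite -[false]/(~~ true) -bflip_scons.
  apply: (Tc _ None Ty).
  by rewrite /= bflip_scons scons_eq_zeros => -[].
suff [] : [set y | y <> zeros /\ T (scons true y)] y by [].
apply: (IHn (shift w) _ (~~ e)) => //; first exact: closed_off_zeros_tail.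
split; first by case: (e); rewrite /= !scons_eq_zeros => -[] // _ [].
case: e Te {ey} => /= Te.
  rewrite -[true in scons true (scons _ _)]/(~~ false) -bflip_scons.
  apply: (Tc _ None Te).
  by rewrite /= bflip_scons scons_eq_zeros => -[].
have [k wk] := other_label (shift w 0).
have E : lact w (Some k) (scons true zeros) =
    scons true (scons false (scons true zeros)).
  by rewrite /= bspinal_true -{1}scons_false_zeros bspinal_false (negbTE wk).
by rewrite -E; apply: Tc Te _; rewrite E scons_eq_zeros => -[].
Qed.

Lemma one_zerosE : one_zeros = scons true zeros.
Proof. by apply/funext => -[]. Qed.

Lemma gamma_adjP w (u v : gvertex w) :
  gamma_adj u v <-> exists l, val v = lact w l (val u).
Proof.
split=> [[s /gensP[l ->]]|[l vE]].
  by rewrite !boundary_act_gen => -[E|E]; exists l; rewrite E ?lactK.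
exists (gen w l); first by apply/gensP; exists l.
by left; rewrite boundary_act_gen.
Qed.

Lemma last_one_right_component w x : last_one false x ->
  exists2 v : gvertex w, val v = x & right_component v.
Proof.
have lactE (l : letter) (u : gvertex w) :
    exists u' : gvertex w, val u' = lact w l (val u).
  have lS : grigorchuk_gens w (gen w l) by apply/gensP; exists l.
  exists (gvertex_act (Sub (gen w l) (gens_grigorchuk lS)) u).
  by rewrite /= -boundary_act_gen.
apply: (@last_one_reachable w
  [set x | exists2 u : gvertex w, val u = x & right_component u] false).
  move=> _ l [u <- ru] l0; have [u' u'E] := lactE l u; exists u' => //.
  by apply: (right_step ru); [apply/gamma_adjP; exists l|rewrite u'E].
have [u uE] := lactE None (Sub zeros (gvertex_zerosP (w := w))).
by exists u => //; apply: right_base; rewrite uE one_zerosE.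
Qed.

Lemma right_componentP w (v : gvertex w) :
  right_component v <-> last_one false (val v).
Proof.
split=> [|/(last_one_right_component w)[u /val_inj->//]].
elim=> [u ->|u u' _ IHu /gamma_adjP[l ->] l0].
  by rewrite one_zerosE last_one_scons; left.
by have [|/l0] := last_one_lact w l IHu.
Qed.

Lemma gamma_plusP w (v : gvertex w) :
  gamma_plus v <-> halfline true false (val v).
Proof.
rewrite /gamma_plus /halfline /= right_componentP.
by split=> [[]|[[]|]]; [left|right|left|right].
Qed.

Lemma halfline_gvertex w x : halfline true false x ->
  exists2 v : gvertex w, val v = x & gamma_plus v.
Proof.
move=> [[-> _]|/(last_one_right_component w)[v vx vr]]; last first.
  by exists v => //; right.
by exists (Sub zeros (gvertex_zerosP (w := w))) => //; left.
Qed.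

(** The group acts faithfully on infinite words, and only finitely many
    vertices have to be ignored for [A] to become a half-line. *)
Lemma cvertex_stab_finite w (A : set (gvertex w)) : without_repetition w ->
  is_cvertex A ->
  finite_set [set g : grigorchuk w | forall v, A v <-> A (gvertex_act g v)].
Proof.
move=> hw Avert.
have /finite_seqP[s sE] := Avert.
have [n sn] := gvertex_seq_bounded s.
pose A' := val @` A.
have A'fin : finite_set (stabset w A').
  apply: (@stab_finite w A' true false n hw) => x xn.
  have nD v : val v = x -> ~ (A `+` gamma_plus) v.
    by move=> vx; rewrite sE => /sn; rewrite vx => /xn.
  split=> [[v Av vx]|/(halfline_gvertex w)[v vx gv]].
    rewrite -vx; apply/gamma_plusP; apply: contrapT => gv.
    by apply: (nD v vx); left.
  by exists v => //; apply: contrapT => Av; apply: (nD v vx); right.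
pose f (g : grigorchuk w) := boundary_act (val g).
have finj : {in f @^-1` stabset w A' &, injective f}.
  by move=> g h _ _ /boundary_act_inj /val_inj.
apply: sub_finite_set (finite_preimage finj A'fin).
move=> g gA; have [W WE] := boundary_act_word g.
exists W => // x.
rewrite -WE; split=> [[v Av <-]|[u Au ux]].
  by exists (gvertex_act g v) => //; exact: (iffLR (gA v)).
have {}ux : val (gvertex_act g^-1%g u) = x.
  by rewrite /= ux boundary_actK.
exists (gvertex_act g^-1%g u) => //.
by apply: (iffRL (gA _)); rewrite gvertex_actVK.
Qed.

Local Open Scope ring_scope.

(** * Proper isometric actions *)

Section OrbitProjection.
Context {G : groupType} (X : gSpace G).

Definition orbit_pi (x : X) : orbit_space X := (\pi_(orbit_space X) x)%qT.

Lemma orbit_piP x y : orbit_pi x = orbit_pi y <-> exists g, y = gact g x.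
Proof.
split=> [/eqmodP/asboolP//|H].
by apply/eqmodP/asboolP.
Qed.

Lemma orbit_pi_gact g x : orbit_pi (gact g x) = orbit_pi x.
Proof. by apply/esym/orbit_piP; exists g. Qed.

Lemma orbit_pi_repr (q : orbit_space X) : orbit_pi (repr q) = q.
Proof. by rewrite /orbit_pi reprK. Qed.

Lemma orbit_openE (U : set (orbit_space X)) : open U = open (orbit_pi @^-1` U).
Proof. by []. Qed.

Lemma gactK g : cancel (@gact G X g) (gact g^-1%g).
Proof. by move=> x; rewrite -gactM mulVg gact1. Qed.

Lemma gactVK g : cancel (@gact G X g^-1%g) (gact g).
Proof. by move=> x; rewrite -gactM mulgV gact1. Qed.

End OrbitProjection.

Section IsometricAction.
Context {R : realType} {G : groupType} (X : gSpace G) (d : X -> X -> R).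
Hypothesis d_eq0 : forall x y, d x y = 0 <-> x = y.
Hypothesis d_sym : forall x y, d x y = d y x.
Hypothesis d_tri : forall x y z, d x z <= d x y + d y z.
Hypothesis d_nbhs : forall x (A : set X), nbhs x A <->
  exists2 e : R, 0 < e & [set y | d x y < e] `<=` A.
Hypothesis d_gact : forall g x y, d (gact g x) (gact g y) = d x y.
Hypothesis d_discrete : forall x, exists2 e : R, 0 < e &
  forall g, d (gact g x) x < e -> gact g x = x.
Hypothesis stab_fin : forall x : X, finite_set [set g : G | gact g x = x].

Let dxx x : d x x = 0. Proof. exact/d_eq0. Qed.

Let d_ge0 x y : 0 <= d x y.
Proof.
by have := d_tri x y x; rewrite dxx (d_sym y) -mulr2n pmulrn_lge0.
Qed.

Let d_gactV g x y : d (gact g x) y = d x (gact g^-1%g y).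
Proof. by rewrite -(d_gact g x) gactVK. Qed.

Definition orbit_dist x y : R := inf [set d x (gact g y) | g in [set: G]].

Lemma orbit_dist_lt x y e : orbit_dist x y < e <-> exists g, d x (gact g y) < e.
Proof.
split=> [/inf_lt[|_ [g _ <-]]|[g]].
- by exists (d x (gact 1%g y)), 1%g.
- by exists g.
apply: le_lt_trans; apply: ge_inf; last by exists g.
by exists 0 => _ [h _ <-].
Qed.

Lemma orbit_dist_ge0 x y : 0 <= orbit_dist x y.
Proof.
apply: lb_le_inf; first by exists (d x (gact 1%g y)), 1%g.
by move=> _ [h _ <-].
Qed.

Lemma orbit_dist_gact g h x y :
  orbit_dist (gact g x) (gact h y) = orbit_dist x y.
Proof.
congr inf; apply/seteqP; split=> _ [k _ <-].
  by exists (g^-1 * k * h)%g => //; rewrite !gactM d_gactV.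
by exists (g * k * h^-1)%g => //; rewrite !gactM gactK d_gact.
Qed.

Lemma ler_of_lt_imp (a b : R) : (forall e, b < e -> a < e) -> a <= b.
Proof.
move=> H; rewrite leNgt; apply/negP => /H; by rewrite ltxx.
Qed.

Lemma orbit_dist_sym x y : orbit_dist x y = orbit_dist y x.
Proof.
have H u v : orbit_dist u v <= orbit_dist v u.
  apply: ler_of_lt_imp => e /orbit_dist_lt[g ug].
  by apply/orbit_dist_lt; exists g^-1%g; rewrite -d_gactV d_sym.
by apply/eqP; rewrite eq_le !H.
Qed.

Lemma orbit_dist_tri x y z :
  orbit_dist x z <= orbit_dist x y + orbit_dist y z.
Proof.
apply: ler_of_lt_imp => e; rewrite -ltrBrDr.
move=> /orbit_dist_lt[g]; rewrite ltrBrDl -ltrBrDr.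
move=> /orbit_dist_lt[h hz]; apply/orbit_dist_lt; exists (g * h)%g.
apply: le_lt_trans (d_tri _ (gact g y) _) _.
by rewrite gactM d_gact addrC -ltrBrDr.
Qed.

(** Two points of the orbit of y that are both close to x are close to each
    other, hence equal as orbits are discrete; so the infimum is attained when
    it is 0. *)
Lemma orbit_dist_eq0 x y : orbit_dist x y = 0 <-> exists g, y = gact g x.
Proof.
split=> [xy|[g ->]]; last first.
  apply/eqP; rewrite eq_le orbit_dist_ge0 andbT; apply: ler_of_lt_imp => e e0.
  by apply/orbit_dist_lt; exists g^-1%g; rewrite gactK dxx.
have [e e0 He] := d_discrete y.
have [|g xg] := (orbit_dist_lt x y (e / 2)).1; first by rewrite xy divr_gt0.
suff -> : x = gact g y by exists g^-1%g; rewrite gactK.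
apply/d_eq0/eqP; rewrite eq_le d_ge0 andbT; apply: ler_of_lt_imp => c c0.
have [|h xh] := (orbit_dist_lt x y (Num.min c (e / 2))).1.
  by rewrite xy lt_min c0 divr_gt0.
move: xh; rewrite lt_min => /andP[xc xe].
suff -> : gact g y = gact h y by [].
rewrite -[RHS](gactVK g); congr (gact g _); rewrite -gactM; apply/esym/He.
rewrite gactM d_gactV invgK [e]splitr.
by apply: le_lt_trans (d_tri _ x _) _; rewrite ltrD // d_sym.
Qed.

Definition orbit_space_dist (q r : orbit_space X) : R :=
  orbit_dist (repr q) (repr r).

Lemma orbit_space_dist_pi x y :
  orbit_space_dist (orbit_pi x) (orbit_pi y) = orbit_dist x y.
Proof.
rewrite /orbit_space_dist.
have [g ->] := (orbit_piP x (repr (orbit_pi x))).1 (esym (orbit_pi_repr _)).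
have [h ->] := (orbit_piP y (repr (orbit_pi y))).1 (esym (orbit_pi_repr _)).
exact: orbit_dist_gact.
Qed.

Lemma orbit_space_metrizable : metrizable R (orbit_space X).
Proof.
exists orbit_space_dist; split.
- move=> p q; rewrite orbit_dist_eq0 -orbit_piP.
  by rewrite !orbit_pi_repr.
- by move=> p q; exact: orbit_dist_sym.
- by move=> p q r; exact: orbit_dist_tri.
move=> p A; rewrite -(orbit_pi_repr p); set x := repr p.
split.
  rewrite nbhsE => -[B [oB Bx] BA].
  have /d_nbhs[e e0 eB] : nbhs x (orbit_pi (X := X) @^-1` B).
    by apply: open_nbhs_nbhs; split.
  exists e => // q; rewrite -(orbit_pi_repr q) /= orbit_space_dist_pi.
  move=> /orbit_dist_lt[g xg]; apply: BA.
  by rewrite -(orbit_pi_gact g); exact: eB.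
move=> [e e0 eA]; rewrite nbhsE.
exists [set q | orbit_space_dist (orbit_pi x) q < e] => //.
split; last first.
  rewrite /= orbit_space_dist_pi; apply/orbit_dist_lt.
  by exists 1%g; rewrite gact1 dxx.
rewrite orbit_openE openE => y /=; rewrite orbit_space_dist_pi.
move=> /orbit_dist_lt[g xg]; apply/d_nbhs; exists (e - d x (gact g y)).
  by rewrite subr_gt0.
move=> z /= yz; rewrite orbit_space_dist_pi; apply/orbit_dist_lt; exists g.
apply: le_lt_trans (d_tri _ (gact g y) _) _.
by rewrite d_gact -ltrBrDl.
Qed.

(** The points of the orbit of x are at distance at least e from each other. A
    point within e/2 of the orbit is thus sent to the set of the g such that it
    is within e/2 of gx, a coset of the stabilizer of x. *)
Lemma proper_isometric_action : proper_action R X.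
Proof.
split; [by exists d; split| exact: orbit_space_metrizable|move=> x].
have [e e0 He] := d_discrete x.
have e2 : 0 < e / 2 by rewrite divr_gt0.
pose H := [set g : G | gact g x = x].
pose rho (y : X) : discrete_topology (set G) :=
  [set g | d y (gact g x) < e / 2].
pose U := [set y | exists g, d y (gact g x) < e / 2].
have rhoE y g : rho y g -> rho y = [set (g * h)%g | h in H].
  move=> yg; apply/seteqP; split=> k.
    move=> yk; exists (g^-1 * k)%g; last by rewrite mulgA mulgV mul1g.
    apply: He; rewrite gactM d_gactV invgK [e]splitr.
    by apply: le_lt_trans (d_tri _ y _) _; rewrite ltrD // d_sym.
  by move=> [h hH <-]; rewrite /rho /= gactM hH.
have Uopen : open U.
  rewrite openE => y [g yg]; apply/d_nbhs; exists (e / 2 - d y (gact g x)).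
    by rewrite subr_gt0.
  move=> z /= yz; exists g; apply: le_lt_trans (d_tri _ y _) _.
  by rewrite d_sym -ltrBrDr.
exists U, H, rho; split.
- by split=> //; exists 1%g; rewrite gact1 dxx.
- by move=> g y [h yh]; exists (g * h)%g; rewrite gactM d_gact.
- split; last exact: stab_fin.
  split=> [|g h gx hx]; first by rewrite /H /= gact1.
  by rewrite /H /= gactM -{1}hx gactK.
- rewrite continuous_open_subspace // => y /set_mem[g yg] A /nbhs_singleton Ay.
  apply/d_nbhs; exists (e / 2 - d y (gact g x)); first by rewrite subr_gt0.
  move=> z /= yz; suff -> : rho z = rho y by [].
  rewrite (rhoE y g yg) (rhoE z g) // /rho /=.
  by apply: le_lt_trans (d_tri _ y _) _; rewrite d_sym -ltrBrDr.
move=> y [g yg]; split; first by exists g; exact: rhoE.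
move=> h; apply/seteqP; split=> k.
  move=> yk; exists (h^-1 * k)%g; last by rewrite mulgA mulgV mul1g.
  by rewrite /rho /= gactM -d_gactV.
by move=> [l yl <-]; rewrite /rho /= gactM d_gact.
Qed.

End IsometricAction.

(** * Geometry of the cube complex *)

Section CubeComplexPoints.
Context {R : realType} {w : nat -> 'I_3}.
Implicit Types x y z : cube_complex R w.

(** The complex is the whole set of the functions with values in [0, 1] that
    agree with the indicator of Gamma_+ off a finite set. In particular
    it is convex. *)
Lemma in_cube_of_support (f : gvertex w -> R) :
  (forall v, 0 <= f v <= 1) ->
  finite_set [set v | f v <> \1_(@gamma_plus w) v] ->
  exists c : cube w, in_cube c f.
Proof.
move=> f01; set D := [set v | _] => Dfin.
have AV : is_cvertex ((@gamma_plus w) `\` D).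
  by apply: finite_setYD Dfin; rewrite setYK.
have AD : ((@gamma_plus w) `\` D) `&` D = set0.
  by apply/seteqP; split=> // v [[_ nD] /nD].
have offD v : ~ D v -> f v = \1_(@gamma_plus w) v by move/contrapT.
exists (Cube AV Dfin AD) => v; split=> /=.
- by move=> [gv /offD->]; rewrite indicE mem_set.
- by move=> _; exact: f01.
- move=> nAD nD; rewrite offD // indicE memNset // => gv.
  exact: nAD.
Qed.

Lemma coord01 x v : 0 <= x v <= 1.
Proof.
have [c /(_ v)[x1 xF x0]] := coordP x.
have [cv|cv] := pselect (cbase c v); first by rewrite x1 // ler01 lexx.
have [dv|dv] := pselect (cdirs c v); first exact: xF.
by rewrite x0 // lexx ler01.
Qed.

Lemma coord_support x : finite_set [set v | x v <> \1_(@gamma_plus w) v].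
Proof.
have [[A F FA Ffin AF] cx] := coordP x.
apply: (@sub_finite_set _ _ ((A `+` gamma_plus) `|` F)); last first.
  by rewrite finite_setU.
move=> v /= xv; apply: contrapT => /not_orP[Av Fv]; apply: xv.
have [/= x1 _ x0] := cx v; rewrite indicE.
have [gv|gv] := pselect (gamma_plus v).
  rewrite mem_set // x1 //; apply: contrapT => nA; apply: Av; by right.
rewrite memNset // x0 // => Av'; apply: Av; by left.
Qed.

(** The sum has finite support, two points differing in finitely many
    coordinates only. *)
Definition l2 x y : R :=
  Num.sqrt (\sum_(v \in [set: gvertex w]) (x v - y v) ^+ 2).

Lemma euclidean_distE (c : cube w) x y :
  in_cube c x -> in_cube c y -> euclidean_dist c x y = l2 x y.
Proof.
move=> cx cy; congr Num.sqrt; apply: fsbig_widen => // v [_ /= cv].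
suff -> : x v = y v by rewrite subrr expr0n.
have [x1 _ x0] := cx v; have [y1 _ y0] := cy v.
by have [bv|bv] := pselect (cbase c v); [rewrite x1 ?y1|rewrite x0 ?y0].
Qed.

Lemma cube_dist_l2 x y : cube_dist x y <= l2 x y.
Proof.
have [c [cx cy]] := common_cube x y.
rewrite -(euclidean_distE cx cy) -[leRHS]addr0; apply: cube_dist_le.
exact: string_cons cx cy (string_nil y).
Qed.

Lemma l2_scale (a : R) x y x' y' :
  (forall v, x v - y v = a * (x' v - y' v)) -> l2 x y = `|a| * l2 x' y'.
Proof.
move=> E; rewrite /l2 -(sqrtr_sqr a) -sqrtrM ?sqr_ge0 // mulr_fsumr.
by congr Num.sqrt; apply: eq_fsbigr => v _; rewrite E exprMn.
Qed.

Lemma l2_ge0 x y : 0 <= l2 x y. Proof. exact: sqrtr_ge0. Qed.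

Lemma coord_le_cube_dist x y v : `|x v - y v| <= cube_dist x y.
Proof.
apply: lb_le_inf; first exact: string_exists.
by move=> l; exact: coord_le_string.
Qed.

(** Makes [segment] below a total function of its parameter, still
    continuous. *)
Definition clamp (t : R) : R := Num.max 0 (Num.min 1 t).

Lemma clamp01 t : 0 <= clamp t <= 1.
Proof. by rewrite /clamp le_max lexx /= ge_max ler01 ge_min lexx. Qed.

Lemma clamp_id t : 0 <= t <= 1 -> clamp t = t.
Proof. by move=> /andP[t0 t1]; rewrite /clamp (min_r t1) (max_r t0). Qed.

Lemma clamp_lip s t : `|clamp s - clamp t| <= `|s - t|.
Proof.
rewrite /clamp /Num.max /Num.min.
by case: (ltP 1 s) => ?; case: (ltP 1 t) => ?; rewrite ?ltr01 //;
  case: (ltP 0 s) => ?; case: (ltP 0 t) => ? //;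
  rewrite ler_norml; apply/andP; split;
  case: (ltP 0 (s - t)) => h; rewrite ?(gtr0_norm h) ?(ler0_norm h); lra.
Qed.

Lemma segment_subproof (t : R) x y : exists c : cube w,
  in_cube c (fun v => (1 - clamp t) * x v + clamp t * y v).
Proof.
apply: in_cube_of_support => [v|].
  have /andP[t0 t1] := clamp01 t.
  have /andP[x0 x1] := coord01 x v; have /andP[y0 y1] := coord01 y v.
  by apply/andP; split; nra.
apply: (@sub_finite_set _ _ ([set v | x v <> \1_(@gamma_plus w) v] `|`
  [set v | y v <> \1_(@gamma_plus w) v])).
  move=> v /= xy; apply: contrapT => /not_orP[/contrapT xv /contrapT yv].
  by apply: xy; rewrite xv yv; ring.
by rewrite finite_setU; split; exact: coord_support.
Qed.

Definition segment (t : R) x y : cube_complex R w :=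
  CubePoint (segment_subproof t x y).

Lemma segmentE t x y v : 0 <= t <= 1 ->
  segment t x y v = (1 - t) * x v + t * y v.
Proof. by move=> t01; rewrite /= clamp_id. Qed.

Lemma segment_sym t x y : segment t x y = segment (1 - clamp t) y x.
Proof.
apply: cube_complex_eq => v; have /andP[t0 t1] := clamp01 t.
rewrite /= (@clamp_id (1 - clamp t)) ; first by ring.
by apply/andP; split; lra.
Qed.

(** Replacing every point u of a string by the point at parameter t on the
    segment from u to y multiplies the lengths by 1 - t. *)
Lemma segment_dist_l t x x' y :
  cube_dist (segment t x y) (segment t x' y) <= cube_dist x x'.
Proof.
apply: lb_le_inf; first exact: string_exists.
move=> l; elim=> [u|c u u' {}x' {}l cu cu' _ IH]; first by rewrite cube_distxx.
apply: le_trans (cube_dist_triangle (segment t u' y) _ _) _.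
apply: lerD => //; rewrite (euclidean_distE cu cu').
apply: le_trans (cube_dist_l2 _ _) _.
rewrite (@l2_scale (1 - clamp t) _ _ u u'); last by move=> v /=; ring.
have /andP[t0 t1] := clamp01 t; rewrite ger0_norm ?subr_ge0 //.
by rewrite ler_piMl ?l2_ge0 // gerBl.
Qed.

Lemma segment_dist_r t x y y' :
  cube_dist (segment t x y) (segment t x y') <= cube_dist y y'.
Proof. by rewrite !(segment_sym t x); exact: segment_dist_l. Qed.

Lemma segment_dist_t s t x y :
  cube_dist (segment s x y) (segment t x y) <= `|s - t| * l2 x y.
Proof.
apply: le_trans (cube_dist_l2 _ _) _.
rewrite (@l2_scale (clamp t - clamp s) _ _ x y); last by move=> v /=; ring.
by rewrite distrC ler_wpM2r ?l2_ge0 // clamp_lip.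
Qed.

End CubeComplexPoints.

Section CubeComplexAction.
Context {R : realType} {w : nat -> 'I_3}.
Implicit Types (x y : cube_complex R w) (g : grigorchuk w).

Lemma cube_dist_act g x y :
  cube_dist (cube_complex_act g x) (cube_complex_act g y) = cube_dist x y.
Proof.
have H (h : grigorchuk w) (u v : cube_complex R w) :
    cube_dist (cube_complex_act h u) (cube_complex_act h v) <= cube_dist u v.
  apply: lb_le_inf; first exact: string_exists.
  by move=> l uv; apply: cube_dist_le; exact: cube_complex_act_string.
apply/eqP; rewrite eq_le H /=.
have := H g^-1%g (cube_complex_act g x) (cube_complex_act g y).
by rewrite -!cube_complex_actM mulVg !cube_complex_act1.
Qed.

Lemma coord_finite_range x : finite_set (range x).
Proof.
apply: (@sub_finite_set _ _
  ((x @` [set v | x v <> \1_(@gamma_plus w) v]) `|` [set 0; 1])).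
  move=> _ [v _ <-].
  have [xv|xv] := pselect (x v = \1_(@gamma_plus w) v); last by left; exists v.
  by right; rewrite xv indicE; case: (_ \in _); [right|left].
rewrite finite_setU; split; first exact/finite_image/coord_support.
exact: finite_set2.
Qed.

Lemma finite_set_separated (S : set R) : finite_set S ->
  exists2 e : R, 0 < e & forall a b, S a -> S b -> `|a - b| < e -> a = b.
Proof.
move=> /finite_seqP[s ->].
have H a : exists2 e : R, 0 < e & forall b, b \in s -> `|a - b| < e -> a = b.
  elim: s => [|c s [e e0 He]]; first by exists 1.
  have [ac|ac] := eqVneq a c.
    by exists e => // b; rewrite inE => /predU1P[->|]; [|exact: He].
  exists (Num.min e `|a - c|); first by rewrite lt_min e0 normr_gt0 subr_eq0.
  move=> b; rewrite inE lt_min => /predU1P[->|bs /andP[ab _]]; last exact: He.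
  by rewrite ltxx andbF.
suff [e e0 He] : exists2 e : R, 0 < e &
    forall a b, a \in s -> b \in s -> `|a - b| < e -> a = b.
  by exists e => // a b; exact: He.
have {}H : forall s' : seq R, exists2 e : R, 0 < e &
    forall a b, a \in s' -> b \in s -> `|a - b| < e -> a = b.
  elim=> [|c s' [e e0 He]]; first by exists 1.
  have [f f0 Hf] := H c; exists (Num.min e f); first by rewrite lt_min e0.
  move=> a b; rewrite inE lt_min => /predU1P[->|as'] bs /andP[ae af].
    exact: Hf.
  exact: He.
exact: H.
Qed.

(** The group permutes the coordinates of a point, which take finitely many
    values: a translate of x whose coordinates are close to those of x is x. *)
Lemma cube_orbit_discrete x : exists2 e : R, 0 < e &
  forall g, cube_dist (cube_complex_act g x) x < e -> cube_complex_act g x = x.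
Proof.
have [e e0 He] := finite_set_separated (coord_finite_range x).
exists e => // g gx; apply: cube_complex_eq => v.
apply: He; [by exists (gvertex_act g^-1%g v)|by exists v|].
exact: le_lt_trans (coord_le_cube_dist _ _ v) gx.
Qed.

(** An element fixing x stabilizes the set of the vertices where x is 1, which
    differs from Gamma_+ by a finite set. *)
Lemma cube_stab_finite x : without_repetition w ->
  finite_set [set g : grigorchuk w | cube_complex_act g x = x].
Proof.
move=> hw; pose A := [set v | x v = 1].
have Avert : is_cvertex A.
  apply: sub_finite_set (coord_support x) => v /=; rewrite indicE /A /=.
  by case=> -[h1 h2]; [rewrite memNset|rewrite mem_set] => // h3;
    move: h1 h2; rewrite h3 // => /eqP; rewrite eq_sym oner_eq0.
apply: sub_finite_set (cvertex_stab_finite hw Avert) => g gx v.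
rewrite /A /= -{2}gx /= gvertex_actK; exact: iff_refl.
Qed.

Lemma cube_complex_nbhs x (A : set (cube_complex R w)) :
  nbhs x A <-> exists2 e : R, 0 < e & [set y | cube_dist x y < e] `<=` A.
Proof. by rewrite -nbhs_ballE; split=> -[e e0 eA]; exists e. Qed.

Lemma cube_complex_proper : without_repetition w ->
  proper_action R (grigorchuk_cube_complex R w).
Proof.
move=> hw.
apply: (@proper_isometric_action _ _ (grigorchuk_cube_complex R w)
  (@cube_dist R w)).
- by move=> x y; split=> [|->]; [exact: cube_dist_eq0|exact: cube_distxx].
- exact: cube_dist_sym.
- by move=> x y z; exact: cube_dist_triangle.
- exact: cube_complex_nbhs.
- exact: cube_dist_act.
- exact: cube_orbit_discrete.
- by move=> x; exact: cube_stab_finite.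
Qed.

End CubeComplexAction.

(** * Partitions of unity on pseudometric spaces *)

Lemma cvg_sumr {R : realType} (T : topologicalType) (F : nat -> T -> R)
    (y : T) N :
  (forall n, F n @ y --> F n y) ->
  (fun z => \sum_(0 <= n < N) F n z) @ y --> \sum_(0 <= n < N) F n y.
Proof.
move=> Fc; elim: N => [|N IHN].
  rewrite big_nil; under eq_fun do rewrite big_nil.
  exact: cvg_cst.
rewrite big_nat_recr //; under eq_fun do rewrite big_nat_recr //.
by apply: cvgD IHN _; exact: Fc.
Qed.

Section PartitionOfUnity.
Context {R : realType} (Y : topologicalType) (D : Y -> Y -> R).
Context (I : choiceType) (U : I -> set Y).
Hypothesis Dxx : forall x, D x x = 0.
Hypothesis D_sym : forall x y, D x y = D y x.
Hypothesis D_tri : forall x y z, D x z <= D x y + D y z.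
Hypothesis D_nbhs : forall x (e : R), 0 < e -> nbhs x [set y | D x y < e].
Hypothesis U_open : forall i x, U i x ->
  exists2 e : R, 0 < e & forall y, D x y < e -> U i y.
Hypothesis U_cover : forall x, exists i, U i x.

Variable le : rel I.
Hypothesis le_wo : well_order le.

Definition least x i := U i x /\ forall j, U j x -> le i j.

Lemma least_exists x : exists i, least x i.
Proof.
have [|i [[Ui iP] _]] := le_wo (A := [pred i | `[< U i x >]]).
  by have [i Ui] := U_cover x; exists i; apply/asboolP.
exists i; split; first exact/asboolP.
by move=> j Uj; apply: iP; apply/asboolP.
Qed.

Lemma least_anti x y i j : least x i -> least y j -> U i y -> U j x -> i = j.
Proof.
move=> [_ xi] [_ yj] Uiy Ujx.
have le_chain : wo_chain le predT by exact: withinW.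
by apply: (wo_chain_antisymmetric le_chain) => //; rewrite xi // yj.
Qed.

Definition radius (n : nat) : R := n.+1%:R^-1.

Let radius_gt0 n : 0 < radius n.
Proof. by rewrite invr_gt0. Qed.

Let radius_le1 n : radius n <= 1.
Proof. by rewrite invf_le1 // ler1n. Qed.

(** The points seeing [U i], the least set of the cover that contains them, at
    the scale [radius n]. *)
Definition core n i : set Y :=
  [set x | least x i /\ forall y, D x y < 3 * radius n -> U i y].

Definition near_core n y i := exists2 x, core n i x & D y x < radius n.

(** At a given scale, the cores belonging to different indices are far from
    each other, since one of their indices is not the least one at a point of
    the other core. *)
Lemma near_core_uniq n y i j : near_core n y i -> near_core n y j -> i = j.
Proof.
move=> [x [xi xU] yx] [z [zj zU] yz].
have r0 := radius_gt0 n.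
have xz : D x z < 3 * radius n.
  by have := D_tri x y z; rewrite (D_sym x y); lra.
by apply: (least_anti xi zj); [exact: xU|apply: zU; rewrite D_sym].
Qed.

Lemma near_core_sub n y i : near_core n y i -> U i y.
Proof.
have r0 := radius_gt0 n.
by move=> [x [_ xU] yx]; apply: xU; rewrite D_sym; lra.
Qed.

(** The supremum of these numbers is radius n / 2 minus the distance to the
    union of the cores, cut at 0; having 0 among them avoids a special case
    when the cores are empty. *)
Definition heights n y : set R :=
  [set a | a = 0 \/ exists i x, core n i x /\ a = radius n / 2 - D y x].

Definition height n y : R := sup (heights n y).

Let D_ge0 x y : 0 <= D x y.
Proof. by have := D_tri x y x; rewrite Dxx (D_sym y); lra. Qed.

Lemma heights_ub n y : ubound (heights n y) (radius n / 2).
Proof.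
move=> _ [->|[i [x [_ ->]]]]; first by rewrite divr_ge0 // ltW.
by rewrite gerBl.
Qed.

Lemma height_ge n y a : heights n y a -> a <= height n y.
Proof. by apply: ub_le_sup; exists (radius n / 2); exact: heights_ub. Qed.

Lemma height_ge0 n y : 0 <= height n y.
Proof. by apply: height_ge; left. Qed.

Lemma height_le1 n y : height n y <= 1.
Proof.
apply: le_trans (_ : radius n / 2 <= 1); last first.
  by have := radius_le1 n; have := radius_gt0 n; lra.
by apply: ge_sup; [exists 0; left|exact: heights_ub].
Qed.

Lemma height_lip n y z : height n y <= height n z + D y z.
Proof.
apply: ge_sup; first by exists 0; left.
move=> _ [->|[i [x [cx ->]]]]; first by rewrite addr_ge0 // height_ge0.
have hz : radius n / 2 - D z x <= height n z.
  by apply: height_ge; right; exists i, x.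
by have := D_tri z y x; rewrite (D_sym z y); lra.
Qed.

Lemma height_gt0 n y : 0 < height n y ->
  exists i, exists2 x, core n i x & D y x < radius n / 2.
Proof.
move=> /sup_gt[|a [->|[i [x [cx ->]]]]]; [by exists 0; left|by rewrite ltxx|].
by rewrite subr_gt0 => yx; exists i, x.
Qed.

Lemma height_cover y : exists n, 0 < height n y.
Proof.
have [i yi] := least_exists y; have [e e0 eU] := U_open yi.1.
have [|n] := @ltr_add_invr R 0 (e / 3); first by rewrite divr_gt0.
rewrite add0r => ne; exists n.
apply: lt_le_trans (height_ge (a := radius n / 2 - D y y) _).
  by rewrite Dxx subr0 divr_gt0.
right; exists i, y; split=> //; split=> // z yz; apply: eU.
apply: lt_trans yz _.
have : radius n < e / 3 by [].
by lra.
Qed.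

Lemma height_continuous n : continuous (height n : Y -> R).
Proof.
move=> y; apply/cvgrPdist_lt => e e0.
have := D_nbhs y e0; apply: filterS => z /= yz.
have := height_lip n y z; have := height_lip n z y; rewrite (D_sym z y).
by rewrite ltr_norml; lra.
Qed.

(** The factor [n] kills all but finitely many functions near a point where one
    of the previous heights is positive, and the first height which is positive
    at a point is left unchanged there. *)
Definition bump n y : R :=
  Num.max 0 (height n y - n%:R * \sum_(0 <= i < n) height i y).

Definition bump_index n y : option I :=
  if pselect (exists i, near_core n y i) is left P then Some (projT1 (cid P))
  else None.

Lemma bump_indexP n y i : near_core n y i -> bump_index n y = Some i.
Proof.
move=> yi; rewrite /bump_index; case: pselect => [P|[]]; last by exists i.
by congr Some; apply: near_core_uniq yi; exact: (projT2 (cid P)).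
Qed.

Lemma bump_ge0 n y : 0 <= bump n y.
Proof. by rewrite /bump le_max lexx. Qed.

Lemma bump_continuous n : continuous (bump n : Y -> R).
Proof.
move=> y.
apply: (@continuous_max R Y (fun=> 0)
  (fun z => height n z - n%:R * \sum_(0 <= i < n) height i z) y).
  exact: cvg_cst.
apply: cvgB; first exact: height_continuous.
apply: cvgMr; apply: cvg_sumr => i; exact: height_continuous.
Qed.

Lemma bump_locally_finite (y : Y) : exists N, \forall z \near y,
  forall n, (N <= n)%N -> bump n z = 0.
Proof.
have [m ym] := height_cover y.
set c := height m y / 2; have c0 : 0 < c by rewrite divr_gt0.
have [k _ kc] := @nbhs_infty_gtr R c^-1.
exists (maxn m.+1 k).
have := D_nbhs y c0; apply: filterS => z /= yz n.
rewrite geq_max => /andP[mn kn].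
have zc : c < height m z.
  by have := height_lip m y z; rewrite {1}/c in yz *; rewrite /c; lra.
apply/max_idPl; rewrite subr_le0.
apply: le_trans (height_le1 n z) _.
have : 1 <= n%:R * c.
  by have := kc n kn; rewrite /= -[c^-1]div1r ltr_pdivrMr // => /ltW.
move/le_trans; apply; apply: ler_wpM2l => //.
apply: le_trans (ltW zc) _.
rewrite (bigD1_seq m) ?iota_uniq ?mem_index_iota //= lerDl.
by apply: sumr_ge0 => i _; exact: height_ge0.
Qed.

Lemma bump_gt0 n y : bump n y != 0 -> 0 < height n y.
Proof.
apply: contraNT; rewrite -leNgt => h0; apply/eqP/max_idPl.
apply: le_trans (_ : height n y <= 0) => //; rewrite gerBl mulr_ge0 //.
by apply: sumr_ge0 => i _; exact: height_ge0.
Qed.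

Lemma bump_cover y : exists n, 0 < bump n y.
Proof.
have [n n0 nmin] := ex_minnP (height_cover y).
exists n; rewrite /bump big1_seq ?mulr0 ?subr0 ?lt_max ?n0 ?orbT // => i.
rewrite mem_index_iota => /andP[_ /andP[_ i_n]].
apply/eqP; rewrite eq_le height_ge0 andbT leNgt; apply/negP => /nmin.
by rewrite leqNgt i_n.
Qed.

Lemma bump_support n y : bump n y != 0 ->
  exists2 i, bump_index n y = Some i & U i y.
Proof.
move=> /bump_gt0 /height_gt0[i [x cx yx]].
have yi : near_core n y i.
  by exists x => //; have := radius_gt0 n; lra.
by exists i; [exact: bump_indexP|exact: near_core_sub yi].
Qed.

(** The support of [height n] is within radius n / 2 of the cores, whereas the
    index is constant up to the distance [radius n]: so every point is either
    in the interior of the region where the index is defined and locally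
    constant, or away from the support. *)
Lemma bump_local n (y : Y) : (\forall z \near y, bump n z = 0) \/
  exists2 i, U i y & \forall z \near y, bump_index n z = Some i.
Proof.
have [[i [x cx yx]]|no] := pselect (exists i, near_core n y i).
  right; exists i; first by apply: (@near_core_sub n); exists x.
  have r0 : 0 < radius n - D y x by rewrite subr_gt0.
  have := D_nbhs y r0; apply: filterS => z /= yz.
  apply: bump_indexP; exists x => //.
  by have := D_tri z y x; rewrite (D_sym z y); lra.
left; have r0 : 0 < radius n / 2 by rewrite divr_gt0.
have := D_nbhs y r0; apply: filterS => z /= yz.
apply/eqP/negP => /negP /bump_gt0 /height_gt0[i [x cx zx]]; apply: no.
by exists i, x => //; have := D_tri y z x; lra.
Qed.

Lemma bump_invariant y z : D y z = 0 ->
  forall n, bump n y = bump n z /\ bump_index n y = bump_index n z.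
Proof.
move=> yz0 n.
have DE x : D y x = D z x.
  apply/eqP; rewrite eq_le; have := D_tri y z x; have := D_tri z y x.
  by rewrite (D_sym z y) yz0 !add0r => -> ->.
have hE m : height m y = height m z.
  congr sup; apply/seteqP; split=> a [->|[i [x [cx ->]]]]; try by left.
    by right; exists i, x; rewrite DE.
  by right; exists i, x; rewrite DE.
split; first by rewrite /bump hE; under eq_bigr do rewrite hE.
have E : near_core n y = near_core n z.
  apply/funext => i; apply/propext; rewrite /near_core.
  by split=> -[x cx yx]; exists x => //; rewrite ?DE // -DE.
by rewrite /bump_index E.
Qed.

End PartitionOfUnity.

(** * Equivariant maps into the cube complex *)

Section Barycenter.
Context {R : realType} {w : nat -> 'I_3}.
Implicit Types x y z : cube_complex R w.

Lemma barycenter (I : choiceType) (s : seq I) (a : I -> R)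
    (q : I -> cube_complex R w) :
  (forall i, 0 <= a i) -> 0 < \sum_(i <- s) a i ->
  exists z : cube_complex R w, forall v,
    z v = (\sum_(i <- s) a i * q i v) / \sum_(i <- s) a i.
Proof.
move=> a0 s0.
suff [c cz] : exists c : cube w, in_cube c
    (fun v => (\sum_(i <- s) a i * q i v) / \sum_(i <- s) a i).
  by exists (CubePoint (ex_intro _ c cz)).
apply: in_cube_of_support => [v|].
  rewrite divr_ge0 ?(ltW s0) //=; last first.
    apply: sumr_ge0 => i _; rewrite mulr_ge0 //.
    by have /andP[] := coord01 (q i) v.
  rewrite ler_pdivrMr // mul1r; apply: ler_sum => i _.
  by rewrite ler_piMr //; have /andP[] := coord01 (q i) v.
apply: (@sub_finite_set _ _
  (\bigcup_(i in [set` s]) [set v | q i v <> \1_(@gamma_plus w) v])).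
  move=> v /= zv; apply: contrapT => nv; apply: zv.
  have -> : \sum_(i <- s) a i * q i v =
      (\sum_(i <- s) a i) * \1_(@gamma_plus w) v.
    rewrite mulr_suml !big_seq; apply: eq_bigr => i si; congr (_ * _).
    by apply: contrapT => qv; apply: nv; exists i.
  by rewrite mulrAC divff ?mul1r // gt_eqF.
by apply: bigcup_finite => [|i _]; [exact: finite_seq|exact: coord_support].
Qed.

Lemma base_point_subproof :
  exists c : cube w, in_cube c (\1_(@gamma_plus w) : gvertex w -> R).
Proof.
apply: in_cube_of_support.
  by move=> v; rewrite indicE; case: (_ \in _); rewrite /= ?lexx ?ler01.
by apply: sub_finite_set (@finite_set0 (gvertex w)) => v /=.
Qed.

Definition base_point : cube_complex R w := CubePoint base_point_subproof.

(** The barycenter of an orbit. *)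
Lemma finite_subgroup_fixpoint (H : set (grigorchuk w)) :
  is_subgroup H -> finite_set H ->
  exists p : cube_complex R w, forall h, H h -> cube_complex_act h p = p.
Proof.
move=> [H1 HV] Hfin.
have HM g h : H g -> H h -> H (g * h)%g.
  move=> Hg Hh; rewrite -[h]invgK; apply: (HV) => //.
  by rewrite -[h^-1%g]mul1g; exact: HV.
have HI g : H g -> H g^-1%g by move=> Hg; rewrite -[g^-1%g]mul1g; exact: HV.
pose s : seq (grigorchuk w) := finmap.enum_fset (fset_set H).
have sumE (F : grigorchuk w -> R) : \sum_(g <- s) F g = \sum_(g \in H) F g.
  by rewrite fsbig_finite.
have [|/=|p pE] :=
  @barycenter _ s (fun=> 1) (fun g => cube_complex_act g base_point).
- by move=> _; exact: ler01.
- rewrite sumE (fsbigD1 1%g) //= ltr_pwDl ?ltr01 //.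
  by apply: fsumr_ge0 => *; exact: ler01.
exists p => h Hh; apply: cube_complex_eq => v.
rewrite [LHS]/= !pE; congr (_ / _); rewrite !sumE.
have -> : H = [set (h^-1 * g)%g | g in H].
  apply/seteqP; split=> g; last by move=> [k Hk <-]; apply: HM => //; exact: HI.
  by move=> Hg; exists (h * g)%g; [exact: HM|rewrite mulgA mulVg mul1g].
rewrite [LHS]fsbig_image; last by move=> g k _ _; exact: mulgI.
have -> : [set (h^-1 * g)%g | g in H] = H.
  apply/seteqP; split=> g.
    by move=> [k Hk <-]; apply: HM => //; exact: HI.
  by move=> Hg; exists (h * g)%g; [exact: HM|rewrite mulgA mulVg mul1g].
apply: eq_fsbigr => g _; rewrite !mul1r /=.
by rewrite invgM invgK gvertex_actM gvertex_actVK.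
Qed.

(** Near [t0] the points stay in a finite-dimensional cube, where the
    Euclidean distance is controlled by finitely many coordinates. *)
Lemma cvg_cube_complex (T : topologicalType) (f : T -> cube_complex R w)
    (t0 : T)
    (K : set (gvertex w)) : finite_set K ->
  (\forall t \near t0, forall v, ~ K v -> f t v = f t0 v) ->
  (forall v, (fun t => f t v) @ t0 --> f t0 v) ->
  f @ t0 --> f t0.
Proof.
move=> Kfin fK fcvg A /cube_complex_nbhs[e e0 eA].
pose s : seq (gvertex w) := finmap.enum_fset (fset_set K).
have sumE t : (forall v, ~ K v -> f t v = f t0 v) ->
    l2 (f t0) (f t) = Num.sqrt (\sum_(v <- s) (f t0 v - f t v) ^+ 2).
  move=> tK; rewrite /l2 /s -fsbig_finite //; congr Num.sqrt.
  apply/esym/fsbig_widen => // v [_ /= vK].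
  by rewrite tK // subrr expr0n.
have cvg0 : (fun t => \sum_(v <- s) (f t0 v - f t v) ^+ 2) @ t0 --> (0 : R).
  elim: s {sumE} => [|v s IHs].
    under eq_fun do rewrite big_nil.
    exact: cvg_cst.
  under eq_fun do rewrite big_cons.
  have fv0 : (fun t => f t0 v - f t v) @ t0 --> (0 : R).
    rewrite -(subrr (f t0 v)); apply: cvgB; first exact: cvg_cst.
    exact: fcvg.
  have -> : nbhs (0 : R) = nbhs (0 * 0 + 0 : R) by rewrite mul0r addr0.
  exact: cvgD (cvgM fv0 fv0) IHs.
have e2 : 0 < e ^+ 2 by rewrite exprn_gt0.
have fe : \forall t \near t0, \sum_(v <- s) (f t0 v - f t v) ^+ 2 < e ^+ 2.
  exact: cvgr_lt cvg0 _ e2.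
change (nbhs t0 (f @^-1` A)); apply: filterS2 fK fe => t tK te.
apply: eA => /=; apply: le_lt_trans (cube_dist_l2 _ _) _.
by rewrite sumE // -(ger0_norm (ltW e0)) -sqrtr_sqr ltr_sqrt.
Qed.

End Barycenter.

Section Universal.
Context {R : realType} {w : nat -> 'I_3}.
Local Notation E := (grigorchuk_cube_complex R w).

(** The straight-line homotopy. It is continuous because the end points and the
    parameter of a segment can be moved one after the other. *)
Lemma segment_homotopy (X : gSpace (grigorchuk w)) (f0 f1 : X -> E) :
  continuous f0 -> equivariant f0 -> continuous f1 -> equivariant f1 ->
  equivariantly_homotopic R f0 f1.
Proof.
move=> c0 e0 c1 e1.
exists (fun p => segment p.2 (f0 p.1) (f1 p.1) : E); split.
- apply: continuous_subspaceT => -[x s] A /cube_complex_nbhs[e egt0 eA].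
  have e3 : 0 < e / 3 by rewrite divr_gt0.
  have near_f (f : X -> E) : continuous f ->
      \forall p \near (x, s),
        cube_dist (f x : cube_complex R w) (f p.1) < e / 3.
    move=> fc; have : (f \o fst) @ (x, s) --> f x.
      apply: (@continuous_comp _ _ _ fst f (x, s)); first exact: cvg_fst.
      exact: fc.
    have fxe : nbhs (f x : cube_complex R w)
        [set z | cube_dist (f x : cube_complex R w) z < e / 3].
      by apply/cube_complex_nbhs; exists (e / 3).
    by move=> H; exact: (H _ fxe).
  pose L := l2 (f0 x : cube_complex R w) (f1 x).
  have near_s : \forall p \near (x, s), `|s - p.2| * L < e / 3.
    have L1 : 0 < L + 1 by rewrite ltr_wpDl ?l2_ge0.
    have : snd @ (x, s) --> s by exact: cvg_snd.
    move=> /cvgrPdist_lt/(_ (e / 3 / (L + 1))).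
    move=> /(_ (divr_gt0 e3 L1)); apply: filterS => p /= sp.
    apply: le_lt_trans (_ : `|s - p.2| * (L + 1) < _).
      by rewrite ler_wpM2l // lerDl.
    by rewrite -ltr_pdivlMr.
  apply: filterS3 near_s (near_f f1 c1) (near_f f0 c0).
  move=> -[y t] /= st1 y1 y0; apply: eA => /=.
  apply: le_lt_trans (cube_dist_triangle
    (segment t (f0 x : cube_complex R w) (f1 x)) _ _) _.
  apply: le_lt_trans (lerD (segment_dist_t _ _ _ _)
    (cube_dist_triangle (segment t (f0 y : cube_complex R w) (f1 x)) _ _)) _.
  have := segment_dist_l t (f0 x : cube_complex R w) (f0 y) (f1 x).
  have := segment_dist_r t (f0 y : cube_complex R w) (f1 x) (f1 y).
  rewrite /L in st1; lra.
- move=> x; apply: cube_complex_eq => v; rewrite segmentE ?lexx ?ler01 //.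
  by rewrite subr0 mul1r mul0r addr0.
- move=> x; apply: cube_complex_eq => v; rewrite segmentE ?lexx ?ler01 //.
  by rewrite subrr mul0r mul1r add0r.
move=> t t01 g x; rewrite e0 e1; apply: cube_complex_eq => v.
by [].
Qed.

(** A coset gH is sent to gp, where p is fixed by H. The map is locally
    constant because the cosets form a discrete space. *)
Lemma slice_map (X : gSpace (grigorchuk w)) (U : set X) (H : set (grigorchuk w))
    (rho : X -> discrete_topology (set (grigorchuk w))) :
  open U -> is_subgroup H -> finite_set H -> {within U, continuous rho} ->
  (forall y, U y -> is_left_coset H (rho y) /\
     forall g, rho (gact g y) = [set (g * h)%g | h in rho y]) ->
  exists F : X -> E,
    (forall g y, U y -> F (gact g y) = gact g (F y)) /\
    (forall y, U y -> \forall z \near y, F z = F y).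
Proof.
move=> oU Hsub Hfin rhoc rhoP.
have [p pH] := @finite_subgroup_fixpoint R w H Hsub Hfin.
pose P (C : set (grigorchuk w)) (q : E) :=
  forall c, C c -> q = cube_complex_act c p.
pose Q (C : set (grigorchuk w)) : E :=
  if pselect (exists q, P C q) is left ex then projT1 (cid ex) else p.
have QP C : is_left_coset H C -> P C (Q C).
  move=> [g CE]; rewrite /Q; case: pselect => [ex|[]].
    exact: (projT2 (cid ex)).
  exists (cube_complex_act g p) => c; rewrite CE => -[h Hh <-].
  by rewrite cube_complex_actM (pH h Hh).
have mem C : is_left_coset H C -> exists c, C c.
  by move=> [g ->]; exists (g * 1)%g; exists 1%g => //; exact: Hsub.1.
have cosetM g C : is_left_coset H C -> is_left_coset H [set (g * h)%g | h in C].
  move=> [k ->]; exists (g * k)%g; apply/seteqP; split=> l.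
    by move=> [_ [h Hh <-] <-]; exists h => //; rewrite mulgA.
  by move=> [h Hh <-]; exists (k * h)%g; [exists h|rewrite mulgA].
exists (fun y => Q (rho y)); split=> [g y Uy|y Uy].
  have [yC yg] := rhoP y Uy; have [c Cc] := mem _ yC.
  rewrite yg (QP _ (cosetM g _ yC) (g * c)%g); last by exists c.
  by rewrite (QP _ yC c Cc) /= cube_complex_actM.
rewrite continuous_open_subspace // in rhoc.
have rho_y : nbhs (rho y) [set rho y].
  by rewrite nbhs_principalE; apply/principal_filterP.
have : nbhs y (rho @^-1` [set rho y]) := rhoc y (mem_set Uy) _ rho_y.
by apply: filterS => z /= ->.
Qed.

End Universal.

Section ClassifyingMap.
Context {R : realType} {w : nat -> 'I_3}.
Local Notation E := (grigorchuk_cube_complex R w).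

Lemma sum_stable (a : nat -> R) N M : (forall n, (N <= n)%N -> a n = 0) ->
  (forall n, (M <= n)%N -> a n = 0) ->
  \sum_(0 <= n < N) a n = \sum_(0 <= n < M) a n.
Proof.
wlog NM : N M / (N <= M)%N => [H aN aM|aN _].
  by case/orP: (leq_total N M) => ?; [|apply: esym]; exact: H.
rewrite [RHS](@big_cat_nat _ _ _ N 0 M) //= [X in _ = _ + X]big1_seq ?addr0 //.
by move=> n /andP[_]; rewrite mem_index_iota => /andP[/aN].
Qed.

(** The space is covered by slices, on which [slice_map] applies. Their images
    in the metrizable orbit space are well ordered; the partition of unity of
    the previous part, built from the distance between orbits, is invariant,
    and the images by the local maps are averaged with its weights. *)
Lemma classifying_map (X : gSpace (grigorchuk w)) : proper_action R X ->
  exists f : X -> E, continuous f /\ equivariant f.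
Proof.
move=> [_ [dq [dq0 dqs dqt dqn]] slices].
pose D (x y : X) := dq (orbit_pi x) (orbit_pi y).
have Dxx x : D x x = 0 by exact/dq0.
have Ds x y : D x y = D y x by exact: dqs.
have Dt x y z : D x z <= D x y + D y z by exact: dqt.
have Dn (x : X) (e : R) : 0 < e -> nbhs x [set y | D x y < e].
  move=> e0; have H : nbhs (orbit_pi x) [set q | dq (orbit_pi x) q < e].
    by apply/dqn; exists e.
  exact: (pi_continuous H).
have Dg g y : D y (gact g y) = 0 by rewrite /D orbit_pi_gact; exact/dq0.
have /choice[sl slP] : forall x : X, exists s : set X * (X -> E),
    [/\ open s.1, s.1 x, forall g y, s.1 y -> s.1 (gact g y),
      forall g y, s.1 y -> s.2 (gact g y) = gact g (s.2 y) &
      forall y, s.1 y -> \forall z \near y, s.2 z = s.2 y].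
  move=> x; have [U [H [rho [[oU Ux] Ug [Hs Hf] rhoc rhoP]]]] := slices x.
  have [F [Fg Fl]] := @slice_map R w X U H rho oU Hs Hf rhoc rhoP.
  by exists (U, F).
pose U (x : X) := (sl x).1.
have Uo (i x : X) : U i x ->
    exists2 e : R, 0 < e & forall y, D x y < e -> U i y.
  have [oU _ Ug _ _] := slP i; move=> Ux.
  have piU : orbit_pi (X := X) @^-1` (orbit_pi (X := X) @` U i) = U i.
    apply/seteqP; split=> y; last by exists y.
    by move=> [z Uz /orbit_piP[g ->]]; exact: Ug.
  have : nbhs (orbit_pi x) (orbit_pi (X := X) @` U i).
    by apply: open_nbhs_nbhs; split; [rewrite orbit_openE piU|exists x].
  move=> /dqn[e e0 eU]; exists e => // y xy.
  by rewrite -piU /=; exact: eU.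
have Uc x : exists i, U i x by exists x; have [] := slP x.
have [le le_wo] := well_ordering_principle X.
pose b n y := bump D U le n y.
pose q n (y : X) : E :=
  if bump_index D U le n y is Some i then (sl i).2 y else base_point.
have b_ge0 n y : 0 <= b n y by exact: bump_ge0.
have sum_gt0 y N : (forall n, (N <= n)%N -> b n y = 0) ->
    0 < \sum_(0 <= n < N) b n y.
  move=> yN; have [m m0] := bump_cover Dxx Ds Dt Uo Uc le_wo y.
  have mN : (m < N)%N.
    by rewrite ltnNge; apply/negP => /yN E0; rewrite -/(b m y) E0 ltxx in m0.
  rewrite (bigD1_seq m) ?iota_uniq ?mem_index_iota //= ltr_pwDl //.
  by apply: sumr_ge0 => n _; exact: b_ge0.
(* The number of terms is left free, as it cannot be chosen continuously. *)
have fP y : exists z : E, forall N, (forall n, (N <= n)%N -> b n y = 0) ->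
    forall v, z v =
      (\sum_(0 <= n < N) b n y * q n y v) / \sum_(0 <= n < N) b n y.
  have [N /nbhs_singleton yN] := bump_locally_finite Dxx Ds Dt Dn Uo Uc le_wo y.
  have [|//|z zE] := @barycenter R w _ (index_iota 0 N) (b^~ y) (q^~ y).
  - by move=> n; exact: b_ge0.
  - exact: sum_gt0.
  exists z => M yM v; rewrite zE; congr (_ / _); apply: sum_stable => // n.
    by move=> /yN Nn; rewrite /b Nn mul0r.
  by move=> /yM ->; rewrite mul0r.
have [f fE] := choice fP.
exists f; split=> [y|g y]; last first.
  have bg n : b n (gact g y) = b n y.
    rewrite /b.
    by have [-> _] := @bump_invariant _ _ D _ U Ds Dt le _ _ (Dg g y) n.
  have [N /nbhs_singleton yN] := bump_locally_finite Dxx Ds Dt Dn Uo Uc le_wo y.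
  apply: cube_complex_eq => v.
  rewrite (fE _ N); last by move=> n /yN; rewrite bg.
  rewrite /= (fE y N); last by move=> n /yN.
  under eq_bigr do rewrite bg.
  under [X in _ / X]eq_bigr do rewrite bg.
  congr (_ / _); apply: eq_bigr => n _.
  have [->|by0] := eqVneq (b n y) 0; first by rewrite !mul0r.
  congr (_ * _); rewrite /q.
  have [_ <-] := @bump_invariant _ _ D _ U Ds Dt le _ _ (Dg g y) n.
  have [i -> Ui] := bump_support Dxx Ds Dt le_wo by0.
  by have [_ _ _ -> //] := slP i.
have [N yN] := bump_locally_finite Dxx Ds Dt Dn Uo Uc le_wo y.
have local : \forall z \near y, forall n : 'I_N,
    forall v, b n z * q n z v = b n z * q n y v.
  apply: filter_forall => n.
  have [b0|[i Ui qi]] := @bump_local _ _ D _ U Dxx Ds Dt Dn le le_wo n y.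
    by apply: filterS b0 => z bz v; rewrite /b bz !mul0r.
  have yi := nbhs_singleton qi.
  have [_ _ _ _ /(_ y Ui) Fl] := slP i.
  apply: filterS2 qi Fl => z zi Fz v.
  by rewrite /q zi yi Fz.
have fN : \forall z \near y, forall v,
    f z v = (\sum_(0 <= n < N) b n z * q n y v) / \sum_(0 <= n < N) b n z.
  apply: filterS2 yN local => z zN zl v.
  rewrite (fE z N) //; congr (_ / _).
  by rewrite !big_mkord; apply: eq_bigr => n _; exact: zl.
have fNy := nbhs_singleton fN.
have y_gt0 := sum_gt0 y N (nbhs_singleton yN).
have bc n : b n @ y --> b n y.
  exact: (@bump_continuous _ _ D _ U Dxx Ds Dt Dn le n y).
have near_gt0 : \forall z \near y, 0 < \sum_(0 <= n < N) b n z.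
  exact: (cvgr_gt _ (@cvg_sumr R X b y N bc) _ y_gt0).
apply: (@cvg_cube_complex R w X f y (\bigcup_(n in [set` index_iota 0 N])
    [set v | q n y v <> \1_(@gamma_plus w) v])).
- by apply: bigcup_finite => [|n _]; [exact: finite_seq|exact: coord_support].
- have E0 z : 0 < \sum_(0 <= n < N) b n z -> (forall v,
      f z v = (\sum_(0 <= n < N) b n z * q n y v) / \sum_(0 <= n < N) b n z) ->
      forall v, ~ (\bigcup_(n in [set` index_iota 0 N])
        [set v | q n y v <> \1_(@gamma_plus w) v]) v ->
      f z v = \1_(@gamma_plus w) v.
    move=> z0 fz v nv; rewrite fz.
    have -> : \sum_(0 <= n < N) b n z * q n y v =
        (\sum_(0 <= n < N) b n z) * \1_(@gamma_plus w) v.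
      rewrite mulr_suml !big_seq; apply: eq_bigr => n nN; congr (_ * _).
      by apply: contrapT => qv; apply: nv; exists n.
    by rewrite mulrAC divff ?mul1r // gt_eqF.
  apply: filterS2 near_gt0 fN => z z0 fz v nv.
  by rewrite (E0 z) // (E0 y).
move=> v.
rewrite fNy.
apply: cvg_trans (near_eq_cvg (f := fun z : X =>
  (\sum_(0 <= n < N) b n z * q n y v) / \sum_(0 <= n < N) b n z) _) _.
  by apply: filterS fN => z ->.
apply: cvgM; first by apply: cvg_sumr => n; apply: cvgMl; exact: bc.
by apply: cvgV; [rewrite gt_eqF|exact: cvg_sumr].
Qed.

End ClassifyingMap.

Theorem theorem4p0p2 (R : realType) (w : nat -> 'I_3)
    (hw : without_repetition w) :
  classifying_space_of_proper_actions R (grigorchuk_cube_complex R w).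
Proof.
split; first exact: cube_complex_proper.
move=> X Xproper; split; first exact: classifying_map.
by move=> f0 f1; exact: segment_homotopy.
Qed.
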